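(* Let $\Delta$ be a simplicial complex on $[n]$. Then $S/I_{\Delta}^{(2)}$ is generalized Cohen-Macaulay if and only if $\Delta$ and $\bigcup_{i\in V}\mathrm{st}_{\Delta}(V\setminus\{i\})$ are Buchsbaum for all subsets $V\subseteq [n]$ with $1\le |V|\le \dim \Delta +1$.
   Context: $k$ is a fixed field, $[n]=\{1,\dots,n\}$, $S=k[x_1,\dots,x_n]$, $\mathfrak m=(x_1,\dots,x_n)S$. A simplicial complex $\Delta$ on $[n]$ is a collection of subsets of $[n]$ closed under taking subsets; its Stanley-Reisner ideal is $I_\Delta=(\prod_{i\in F}x_i : F\subseteq[n], F\notin\Delta)$. The dimension of a face $F$ is $|F|-1$ and $\dim\Delta$ is the maximal dimension of a face. The second symbolic power is $I_\Delta^{(2)}=\bigcap_{F}P_F^2$, where $F$ runs over the facets of $\Delta$ and $P_F=(x_j : j\notin F)S$. For $F\subseteq[n]$, $\mathrm{st}_\Delta(F)=\{H\in\Delta : H\cup F\in\Delta\}$; this is the void complex (no faces at all) if $F\notin\Delta$. For $I$ a proper monomial ideal, $S/I$ is generalized Cohen-Macaulay if the local cohomology module $H^i_{\mathfrak m}(S/I)$ has finite length for all $i<\dim(S/I)$. A (non-void) simplicial complex $\Delta$ is Buchsbaum if $k[\Delta]=S/I_\Delta$ is a Buchsbaum ring; equivalently, $\Delta$ is pure (all facets have the same dimension) and $\widetilde H_j(\mathrm{lk}_\Delta F;k)=0$ for all $F\in\Delta\setminus\{\emptyset\}$ and all $j<\dim\Delta-|F|$, where $\mathrm{lk}_\Delta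 F=\{H\in\Delta : H\cup F\in\Delta,\ H\cap F=\emptyset\}$. The void complex is regarded as Buchsbaum. *)

(* Defs.v *)
From HB Require Import structures.
From mathcomp Require Import all_boot all_order all_algebra.
From mathcomp Require Import mpoly.

Set Implicit Arguments.
Unset Strict Implicit.
Unset Printing Implicit Defensive.

Import GRing.Theory.
Local Open Scope ring_scope.

Definition is_ideal (R : comNzRingType) (J : R -> Prop) : Prop :=
  [/\ J 0, (forall f g, J f -> J g -> J (f + g))
    & forall p f, J f -> J (p * f)].

Definition is_prime_ideal (R : comNzRingType) (P : R -> Prop) : Prop :=
  [/\ is_ideal P, ~ P 1 & forall f g, P (f * g) -> P f \/ P g].

Definition ideal_gen (R : comNzRingType) (G : R -> Prop) (f : R) : Prop :=
  exists2 s : seq (R * R),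
    (forall pg, pg \in s -> G pg.2) & f = \sum_(pg <- s) pg.1 * pg.2.

Definition ideal_mul (R : comNzRingType) (I J : R -> Prop) : R -> Prop :=
  ideal_gen (fun h => exists f g, [/\ I f, J g & h = f * g]).

Definition strict_incl (T : Type) (M N : T -> Prop) : Prop :=
  (forall u, M u -> N u) /\ exists2 u, N u & ~ M u.

(* dim (R/I) >= d: the primes of R/I are the primes of R containing I. *)
Definition krull_dim_ge (R : comNzRingType) (I : R -> Prop) (d : nat) : Prop :=
  exists P : nat -> R -> Prop,
    (forall j, (j <= d)%N ->
       is_prime_ideal (P j) /\ forall f, I f -> P j f) /\
    (forall j, (j < d)%N -> strict_incl (P j) (P j.+1)).

(** Local cohomology of R/I with support in (x_0, ..., x_(n-1)), computed from
    the Cech complex  C^i(R/I) = (+)_(#|A| = i) (R/I)_(x_A),  where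
    x_A = \prod_(i in A) x_i.  Since R is a domain, R_(x_A) is a subring of the
    fraction field (provided that the x_i are nonzero), and (R/I)_(x_A) is
    R_(x_A) / I R_(x_A). Thus H^i is the quotient of two R-submodules of the
    space of families of fractions indexed by the subsets A. *)

(* J R_(x_A), for an ideal J *)
Definition loc_ideal (R : idomainType) (n : nat) (x : 'I_n -> R)
    (J : R -> Prop) (A : {set 'I_n}) (q : {fraction R}) : Prop :=
  exists (f : R) (t : nat),
    J f /\ q = tofrac f / tofrac (\prod_(i in A) x i) ^+ t.

Notation cech_family R n :=
  {ffun {set 'I_n} -> {fraction R}^o} (only parsing).

(* (+)_(#|A| = i) J R_(x_A) *)
Definition cech_cochain (R : idomainType) (n : nat) (x : 'I_n -> R)
    (J : R -> Prop) (i : nat) (u : cech_family R n) : Prop :=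
  forall A : {set 'I_n}, if #|A| == i then loc_ideal x J A (u A) else u A = 0.

Definition cech_diff (R : idomainType) (n : nat)
    (u : cech_family R n) : cech_family R n :=
  [ffun A : {set 'I_n} =>
     \sum_(a in A) (-1) ^+ #|[set b in A | (b < a)%N]| * u (A :\ a)].

Definition cech_cocycle (R : idomainType) (n : nat) (x : 'I_n -> R)
    (I : R -> Prop) (i : nat) (u : cech_family R n) : Prop :=
  cech_cochain x (fun=> True) i u /\ cech_cochain x I i.+1 (cech_diff u).

Definition cech_coboundary (R : idomainType) (n : nat) (x : 'I_n -> R)
    (I : R -> Prop) (i : nat) (u : cech_family R n) : Prop :=
  exists v w : cech_family R n,
    [/\ if i is i'.+1 then cech_cochain x (fun=> True) i' v
        else forall A, v A = 0,
        cech_cochain x I i w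
      & forall A, u A = cech_diff v A + w A].

Definition is_submodule (R : idomainType) (n : nat)
    (N : cech_family R n -> Prop) : Prop :=
  [/\ N 0, (forall u v, N u -> N v -> N (u + v))
    & forall (p : R) u, N u -> N (tofrac p *: u)].

(* The R-module Z/B has finite length: the lengths of the strict chains of its
   submodules, i.e. of the submodules between B and Z, are bounded. *)
Definition finite_length_quot (R : idomainType) (n : nat)
    (Z B : cech_family R n -> Prop) : Prop :=
  exists l : nat, forall (m : nat) (N : nat -> cech_family R n -> Prop),
    (forall j, (j <= m)%N ->
       [/\ is_submodule (N j), (forall u, B u -> N j u)
         & forall u, N j u -> Z u]) ->
    (forall j, (j < m)%N -> strict_incl (N j) (N j.+1)) ->
    (m <= l)%N.

Definition local_cohomology_finite_length (R : idomainType) (n : nat)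
    (x : 'I_n -> R) (I : R -> Prop) (i : nat) : Prop :=
  finite_length_quot (cech_cocycle x I i) (cech_coboundary x I i).

(* i < dim (S/I) is expressed as dim (S/I) >= i + 1. *)
Definition generalized_cohen_macaulay (k : fieldType) (n : nat)
    (I : {mpoly k[n]} -> Prop) : Prop :=
  forall i : nat, krull_dim_ge I i.+1 ->
    local_cohomology_finite_length (fun j : 'I_n => 'X_j) I i.

Definition simplicial_complex (n : nat) (Delta : {set {set 'I_n}}) : Prop :=
  forall F G : {set 'I_n}, F \in Delta -> G \subset F -> G \in Delta.

Definition facets (n : nat) (Delta : {set {set 'I_n}}) : {set {set 'I_n}} :=
  [set F | maxset (fun G : {set 'I_n} => G \in Delta) F].

(* dim Delta + 1, i.e. the largest cardinality of a face (0 for the void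
   complex, as for {set0}) *)
Definition dim_succ (n : nat) (Delta : {set {set 'I_n}}) : nat :=
  \max_(F in Delta) #|F|.

Definition star (n : nat) (Delta : {set {set 'I_n}}) (F : {set 'I_n}) :
    {set {set 'I_n}} :=
  [set H in Delta | H :|: F \in Delta].

Definition link (n : nat) (Delta : {set {set 'I_n}}) (F : {set 'I_n}) :
    {set {set 'I_n}} :=
  [set H in Delta | (H :|: F \in Delta) && (H :&: F == set0)].

Definition pure (n : nat) (Delta : {set {set 'I_n}}) : Prop :=
  forall F G, F \in facets Delta -> G \in facets Delta -> #|F| = #|G|.

(* Chains spanned by the faces of cardinality c, i.e. of dimension c - 1;
   c = 0 gives the augmentation term, spanned by the empty face. *)
Definition is_chain (k : fieldType) (n : nat) (Delta : {set {set 'I_n}})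
    (c : nat) (z : {ffun {set 'I_n} -> k}) : Prop :=
  forall F : {set 'I_n}, z F != 0 -> F \in Delta /\ #|F| = c.

(* The coefficient of G in the boundary of z is collected from the faces
   a |: G, in which a occupies position #|{b in G : b < a}|. *)
Definition boundary (k : fieldType) (n : nat) (z : {ffun {set 'I_n} -> k}) :
    {ffun {set 'I_n} -> k} :=
  [ffun G : {set 'I_n} =>
     \sum_(a | a \notin G) (-1) ^+ #|[set b in G | (b < a)%N]| * z (a |: G)].

(* The reduced homology of Delta over k vanishes in degree c - 1. *)
Definition reduced_homology_vanishes (k : fieldType) (n : nat)
    (Delta : {set {set 'I_n}}) (c : nat) : Prop :=
  forall z : {ffun {set 'I_n} -> k}, is_chain Delta c z -> boundary z = 0 ->
    exists2 b : {ffun {set 'I_n} -> k}, is_chain Delta c.+1 b & boundary b = z.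

(* With j = c - 1, the range j < dim Delta - |F| reads c + |F| < dim Delta + 1;
   for j < -1 the homology is zero. The void complex is vacuously Buchsbaum. *)
Definition buchsbaum (k : fieldType) (n : nat) (Delta : {set {set 'I_n}}) :
    Prop :=
  pure Delta /\
  forall F : {set 'I_n}, F \in Delta -> F != set0 ->
    forall c : nat, (c + #|F| < dim_succ Delta)%N ->
      reduced_homology_vanishes k (link Delta F) c.

(* P_F = (x_j : j notin F) *)
Definition face_ideal (k : fieldType) (n : nat) (F : {set 'I_n}) :
    {mpoly k[n]} -> Prop :=
  ideal_gen (fun f => exists2 j : 'I_n, j \notin F & f = 'X_j).

(* For the void complex the intersection is empty, hence the unit ideal. *)
Definition symbolic_square (k : fieldType) (n : nat)
    (Delta : {set {set 'I_n}}) (f : {mpoly k[n]}) : Prop :=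
  forall F : {set 'I_n}, F \in facets Delta ->
    ideal_mul (face_ideal (k := k) F) (face_ideal (k := k) F) f.

(* Main.v *)
From HB Require Import structures.
Require Import Defs.
From mathcomp Require Import all_boot all_order all_algebra.
From mathcomp Require Import mpoly ring.
From Stdlib Require Import ClassicalEpsilon.

(* Local cohomology of S/I, with I the second symbolic power, is Z^n-graded.
   A monomial x^a with negative support G is nonzero in the localization of S/I
   at x_A iff G is contained in A and some facet F containing A satisfies
   sum_(j notin F) a_j <= 1, so that the part of degree a of the Cech complex is
   the cochain complex of a link of G, as in Takayama's formula.  If some
   a_j >= 2 this link is a cone with apex j, hence acyclic.  Otherwise it is the
   link of G in the complex spanned by the facets missing at most one vertex of
   V = {j | a_j = 1}, that is the union of the stars of the V \ i.  The degrees
   with G nonempty come in infinite families with constant V and G, so finite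
   length means that these links are acyclic below the top degree, for all
   disjoint V and G with G nonempty.  This is the Buchsbaum condition, since the
   link of G only depends on V \ G, and |V| > dim Delta + 1 leaves no G. *)

Set Implicit Arguments.
Unset Strict Implicit.
Unset Printing Implicit Defensive.

Import Order.TTheory GRing.Theory Num.Theory.
Local Open Scope ring_scope.

(** * Linear algebra and signs *)

(** The Buchsbaum condition speaks of homology, the Cech complex of cohomology; the two are
    exchanged by linear duality over k in the form of [fredholm], without any dimension count of
    homology groups. No quotient module is formed: an element of (S/I)_(x_A) is represented by a
    fraction, and equality modulo I is an additive error term in the localized ideal. The part of
    degree a is read off from coefficients of Laurent polynomials inside the fraction field of S.
    The range of i is given by chains of arbitrary primes of S. Monomial primes bound the dimension
    from below, but the upper bound must handle every chain: a chain yields elements that are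
    algebraically independent modulo some P_F, and counting monomials shows that there are at most
    |F| of them. *)

Lemma fredholm (k : fieldType) (T1 T2 : finType) (M : T1 -> T2 -> k)
    (phi : T2 -> k) :
  (forall z : T2 -> k, (forall t1, \sum_t2 M t1 t2 * z t2 = 0) ->
     \sum_t2 phi t2 * z t2 = 0) ->
  exists psi : T1 -> k, forall t2, phi t2 = \sum_t1 psi t1 * M t1 t2.
Proof.
move=> orth.
pose A := \matrix_(i < #|T1|, j < #|T2|) M (enum_val i) (enum_val j).
pose f := \row_(j < #|T2|) phi (enum_val j).
(* A row lies in the row space of A iff the cokernel matrix of A kills it, and each column of that
   matrix is a vector z orthogonal to all rows of A. *)
have /submxP [D fD] : (f <= A)%MS.
  rewrite submxE; apply/eqP/matrixP => i l; rewrite !mxE.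
  transitivity (\sum_(j < #|T2|) phi (enum_val j) * cokermx A j l).
    by apply: eq_bigr => j _; rewrite mxE.
  pose z t := cokermx A (enum_rank t) l.
  transitivity (\sum_t phi t * z t).
    rewrite [RHS](reindex_onto enum_val enum_rank) => [|t _]; last exact: enum_rankK.
    by apply: eq_big => [j | j _]; rewrite /z ?enum_valK ?eqxx.
  apply: orth => t1; transitivity ((A *m cokermx A) (enum_rank t1) l).
    rewrite mxE (reindex_onto enum_val enum_rank) => [|t _]; last exact: enum_rankK.
    by apply: eq_big => [j | j _]; rewrite /z ?enum_valK ?eqxx ?mxE ?enum_rankK.
  by rewrite mulmx_coker mxE.
exists (fun t1 => D 0 (enum_rank t1)) => t2.
have /matrixP/(_ 0 (enum_rank t2)) := fD; rewrite !mxE enum_rankK => ->.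
rewrite [RHS](reindex_onto enum_val enum_rank) => [|t _]; last exact: enum_rankK.
by apply: eq_big => [j | j _]; rewrite ?enum_valK ?eqxx ?mxE ?enum_rankK.
Qed.

Lemma linear_relation (k : fieldType) (T B : finType) (M : T -> B -> k) :
  (#|B| < #|T|)%N ->
  exists v : T -> k, (exists t, v t != 0) /\ forall b, \sum_t v t * M t b = 0.
Proof.
move=> ltBT.
pose A := \matrix_(i < #|T|, j < #|B|) M (enum_val i) (enum_val j).
have /rowV0Pn [r] : kermx A != 0.
  by rewrite -mxrank_eq0 mxrank_ker -lt0n subn_gt0 (leq_ltn_trans (rank_leq_col A)).
move=> /sub_kermxP rA /rV0Pn [i ri].
exists (fun t => r 0 (enum_rank t)); split; first by exists (enum_val i); rewrite enum_valK.
move=> b; have /matrixP/(_ 0 (enum_rank b)) := rA; rewrite !mxE => rAb.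
rewrite -[RHS]rAb (reindex_onto enum_val enum_rank) => [|t _]; last exact: enum_rankK.
by apply: eq_big => [j | j _]; rewrite ?enum_valK ?eqxx ?mxE ?enum_rankK.
Qed.

Section Signs.
Variables (R : comPzRingType) (n : nat).
Implicit Types (A B G H : {set 'I_n}) (a b : 'I_n).

(** The strict inequality gives A and [a |: A] the same sign at a, so that one sign serves both for
    removing and for adding a vertex. *)
Definition sgn A a : R := (-1) ^+ #|[set b in A | (b < a)%N]|.

(** R is kept general because the same operator is the Cech differential over the fraction field and
    the simplicial coboundary over k. *)
Definition codiff (u : {set 'I_n} -> R) A : R :=
  \sum_(a in A) sgn A a * u (A :\ a).

Lemma sgnU A B a : [disjoint A & B] -> sgn (A :|: B) a = sgn A a * sgn B a.
Proof.
move=> dAB; rewrite /sgn -exprD; congr (_ ^+ _).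
have -> : [set b in A :|: B | (b < a)%N] =
    [set b in A | (b < a)%N] :|: [set b in B | (b < a)%N].
  by apply/setP=> b; rewrite !inE andb_orl.
rewrite cardsU; suff -> : [set b in A | (b < a)%N] :&: [set b in B | (b < a)%N] = set0.
  by rewrite cards0 subn0.
apply/setP=> b; rewrite !inE; case bA : (b \in A) => //=.
by rewrite (disjointFr dAB bA) andbF.
Qed.

Lemma sgn_sqr A a : sgn A a * sgn A a = 1.
Proof. by rewrite /sgn -expr2 sqrr_sign. Qed.

Lemma sgn1 a b : sgn [set b] a = (-1) ^+ (b < a)%N.
Proof.
rewrite /sgn; congr (_ ^+ _); case: ltnP => ba.
  rewrite (_ : [set _ in _ | _] = [set b]) ?cards1 //.
  by apply/setP=> c; rewrite !inE; case: eqP => // ->.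
apply/eqP; rewrite cards_eq0; apply/eqP/setP=> c; rewrite !inE.
by case: eqP => // ->; rewrite ltnNge ba.
Qed.

Lemma sgnU1 A a w : w \notin A -> sgn (w |: A) a = (-1) ^+ (w < a)%N * sgn A a.
Proof. by move=> wA; rewrite sgnU ?disjoints1 // sgn1. Qed.

Lemma sgnD1 A a w : w \in A -> sgn A a = (-1) ^+ (w < a)%N * sgn (A :\ w) a.
Proof. by move=> wA; rewrite -{1}(setD1K wA) sgnU1 // setD11. Qed.

(** Of the two removals, only that of the smaller vertex shifts the position of the other one. *)
Lemma sgn_swap A a b : a \in A -> b \in A -> a != b ->
  sgn A a * sgn (A :\ a) b = - (sgn A b * sgn (A :\ b) a).
Proof.
move=> aA bA ab; rewrite (sgnD1 a bA) (sgnD1 b aA).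
case: (ltngtP a b) => [ab' | ba' | /val_inj/eqP]; last by rewrite (negPf ab).
- by rewrite expr0 expr1 mul1r mulN1r mulNr opprK mulrC.
- by rewrite expr0 expr1 mul1r mulN1r mulNr mulrC.
Qed.

Lemma codiffK (u : {set 'I_n} -> R) A : codiff (codiff u) A = 0.
Proof.
rewrite /codiff.
pose T (a b : 'I_n) := sgn A a * (sgn (A :\ a) b * u (A :\ a :\ b)).
transitivity (\sum_(a in A) \sum_(b in A | b != a) T a b).
  apply: eq_bigr => a aA; rewrite big_distrr; apply: eq_bigl => b.
  by rewrite !inE andbC.
(* The pairs are split by order and cancelled one against one: showing that the sum equals its
   opposite would say nothing in characteristic 2. *)
transitivity (\sum_(a in A) \sum_(b in A | (b < a)%N) T a b +
              \sum_(a in A) \sum_(b in A | (a < b)%N) T a b).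
  rewrite -big_split; apply: eq_bigr => a aA /=.
  rewrite (bigID (fun b : 'I_n => (b < a)%N)) /=; congr (_ + _); apply: eq_bigl => b.
    by case: ltngtP; rewrite ?andbT ?andbF // => ba; rewrite neq_ltn ba andbT.
  rewrite -leqNgt leq_eqVlt -(inj_eq val_inj) [val a == _]eq_sym /=.
  by case: ltngtP; rewrite ?andbT ?andbF.
rewrite [X in _ + X](exchange_big_dep (fun b => b \in A)) /=; last by move=> a b _ /andP [].
rewrite -big_split big1 //= => a aA.
rewrite [X in _ + X](eq_bigl (fun b => (b \in A) && (b < a)%N)) => [|b]; last by rewrite aA.
rewrite -big_split big1 //= => b /andP [bA ba].
have nab : a != b by rewrite neq_ltn ba orbT.
rewrite /T !mulrA (sgn_swap aA bA nab) (_ : A :\ a :\ b = A :\ b :\ a).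
  by rewrite mulNr addNr.
by apply/setP=> c; rewrite !inE andbCA.
Qed.

(* The contracting homotopy of a cone with apex w. *)
Lemma cone_homotopy (u : {set 'I_n} -> R) w A :
  let h B := if w \in B then 0 else sgn B w * u (w |: B) in
  codiff h A + (if w \in A then 0 else sgn A w * codiff u (w |: A)) = u A.
Proof.
move=> h; case: ifP => wA.
  rewrite addr0 /codiff (bigD1 w) //= big1 ?addr0 => [|a /andP [aA aw]].
    rewrite /h setD11 mulrA setD1K //.
    by rewrite {1}(sgnD1 w wA) ltnn mul1r sgn_sqr mul1r.
  by rewrite /h !inE eq_sym aw wA mulr0.
have wA' : w \notin A by rewrite wA.
rewrite /codiff (big_setU1 _ wA') /= setU1K // mulrDr mulrA (sgnU1 _ wA') ltnn mul1r sgn_sqr mul1r.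
rewrite addrCA -[RHS]addr0; congr (_ + _).
rewrite big_distrr -big_split big1 //= => a aA.
have aw : a != w by apply: contraNneq wA' => <-.
rewrite /h !inE eq_sym (negPf aw) wA /= !mulrA.
have -> : (w |: A) :\ a = w |: A :\ a.
  apply/setP=> c; rewrite !inE; case: (eqVneq c w) => [->|//]; by rewrite eq_sym aw.
rewrite -mulrDl (_ : _ + _ = 0) ?mul0r //.
have := @sgn_swap (w |: A) a w; rewrite !inE aA eqxx orbT aw => /(_ isT isT isT).
rewrite setU1K // => e.
have wAa : w \notin A :\ a by rewrite !inE wA andbF.
have sw : sgn ((w |: A) :\ a) w = sgn (A :\ a) w.
  rewrite (_ : (w |: A) :\ a = w |: A :\ a) ?sgnU1 ?ltnn ?mul1r //.
  by apply/setP=> c; rewrite !inE; case: (eqVneq c w) => [->|//]; rewrite eq_sym aw.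
move: e; rewrite sw [X in _ = - (X * _)]sgnU1 // ltnn mul1r sgnU1 // -mulrA => e.
have := congr1 (fun x => (-1) ^+ (w < a)%N * x) e.
rewrite /= signrMK => ->.
by rewrite mulrN [X in - X]mulrCA addNr.
Qed.

(** Coboundary and boundary are transposes: pairs (a, A) with a in A match pairs (a, G) with a
    outside G through A = [a |: G]. *)
Lemma sum_codiff (psi z : {set 'I_n} -> R) :
  \sum_A codiff psi A * z A =
  \sum_G psi G * (\sum_(a | a \notin G) sgn G a * z (a |: G)).
Proof.
rewrite /codiff.
under eq_bigr do rewrite big_distrl.
under [RHS]eq_bigr do rewrite big_distrr.
rewrite (exchange_big_dep predT) //= [RHS](exchange_big_dep predT) //=.
apply: eq_bigr => a _.
rewrite (reindex_onto (fun G => a |: G) (fun A => A :\ a)) /=; last first.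
  by move=> A aA; rewrite setD1K.
apply: eq_big => [G | G /andP [_ /eqP aG]].
  rewrite setU11; apply/eqP/idP => [<- | aG]; last exact: setU1K.
  by rewrite setD11.
have aG' : a \notin G by rewrite -aG setD11.
by rewrite aG sgnU1 // ltnn mul1r mulrCA mulrA.
Qed.

End Signs.

(** * Cohomology of links *)

Section Duality.
Variables (k : fieldType) (n : nat).
Implicit Types (K : {set {set 'I_n}}) (A B F G H V : {set 'I_n}).
Implicit Types (phi psi : {set 'I_n} -> k).

(** Puts [codiff] in matrix form, as [fredholm] requires. *)
Lemma codiff_delta psi A :
  codiff psi A = \sum_B psi B * codiff (fun X => (X == B)%:R) A.
Proof.
rewrite /codiff; under [RHS]eq_bigr do rewrite big_distrr.
rewrite exchange_big; apply: eq_bigr => a _ /=.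
rewrite (bigD1 (A :\ a)) //= eqxx mulr1 big1 ?addr0 1?mulrC // => B /negPf.
by rewrite eq_sym => ->; rewrite !mulr0.
Qed.

Lemma eq_codiff phi psi A :
  (forall a, a \in A -> phi (A :\ a) = psi (A :\ a)) -> codiff phi A = codiff psi A.
Proof. by move=> e; apply: eq_bigr => a aA; rewrite e. Qed.

Lemma sum_codiff_boundary psi (z : {ffun {set 'I_n} -> k}) :
  \sum_A codiff psi A * z A = \sum_B psi B * boundary z B.
Proof. by rewrite sum_codiff; apply: eq_bigr => B _; rewrite ffunE. Qed.

(** By [fredholm], phi is a coboundary on K once it pairs to zero with all cycles. A cycle is a
    boundary of some b, and pairing phi with it amounts to pairing [codiff phi] with b. *)
Lemma cohomology_of_homology K c phi :
    reduced_homology_vanishes k K c ->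
    (forall A, A \in K -> #|A| = c.+1 -> codiff phi A = 0) ->
  exists psi, (forall B, psi B != 0 -> #|B|.+1 = c) /\
    forall A, A \in K -> #|A| = c -> phi A = codiff psi A.
Proof.
move=> hom cocyc.
pose inK A := (A \in K) && (#|A| == c).
pose M B A := if inK A then codiff (fun X => (X == B)%:R) A else 0 : k.
have [|psi psiE] := @fredholm k _ _ M (fun A => if inK A then phi A else 0).
  move=> z zorth; pose z' := [ffun A => if inK A then z A else 0] : {ffun _ -> k}.
  have z'chain : is_chain K c z'.
    move=> A; rewrite ffunE; case: ifP => [|_ /eqP //].
    by move=> /andP [AK /eqP].
  have z'cyc : boundary z' = 0.
    apply/ffunP => B; rewrite [RHS]ffunE -[RHS](zorth B).
    transitivity (\sum_A codiff (fun X => (X == B)%:R) A * z' A).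
      rewrite sum_codiff_boundary (bigD1 B) //= eqxx mul1r big1 ?addr0 // => X /negPf ->.
      by rewrite mul0r.
    by apply: eq_bigr => A _; rewrite /M ffunE; case: ifP; rewrite ?mul0r ?mulr0.
  have [b bchain bz] := hom z' z'chain z'cyc.
  transitivity (\sum_A phi A * z' A).
    by apply: eq_bigr => A _; rewrite ffunE; case: ifP; rewrite ?mul0r ?mulr0.
  rewrite -bz -sum_codiff_boundary big1 // => A _.
  have [->|/bchain [AK Ac]] := eqVneq (b A) 0; first by rewrite mulr0.
  by rewrite cocyc ?mul0r.
(* Cutting psi off is harmless: on sets of cardinality c its coboundary only sees sets with one
   element less. *)
exists (fun B => if #|B|.+1 == c then psi B else 0); split.
  by move=> B; case: (_ =P c) => // _; rewrite eqxx.
move=> A AK Ac; have := psiE A; rewrite {1}/inK AK Ac eqxx /= => ->.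
transitivity (codiff psi A).
  by rewrite codiff_delta; apply: eq_bigr => B _; rewrite /M /inK AK Ac eqxx.
apply: eq_codiff => a aA; case: eqP => //; case.
by rewrite -Ac (cardsD1 a A) aA.
Qed.

(** The dual argument, with the transposed matrix: z is a boundary once every cocycle kills it, and
    a cocycle on K is a coboundary there, which pairs to zero with the cycle z. *)
Lemma homology_of_cohomology K c :
    (forall phi, (forall A, A \in K -> #|A| = c.+1 -> codiff phi A = 0) ->
      exists psi, forall A, A \in K -> #|A| = c -> phi A = codiff psi A) ->
  reduced_homology_vanishes k K c.
Proof.
move=> cohom z zchain zcyc.
pose inK A := (A \in K) && (#|A| == c.+1).
pose M A B := if inK A then codiff (fun X => (X == B)%:R) A else 0 : k.
have [|b bE] := @fredholm k _ _ M z.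
  move=> phi phiorth.
  have [A AK Ac|psi psiE] := cohom phi.
    rewrite codiff_delta -[RHS](phiorth A); apply: eq_bigr => B _.
    by rewrite /M /inK AK Ac eqxx mulrC.
  transitivity (\sum_B codiff psi B * z B).
    apply: eq_bigr => B _; have [->|/zchain [BK Bc]] := eqVneq (z B) 0.
      by rewrite mul0r mulr0.
    by rewrite psiE // mulrC.
  by rewrite sum_codiff_boundary zcyc big1 // => B _; rewrite ffunE mulr0.
exists [ffun A => if inK A then b A else 0].
  by move=> A; rewrite ffunE; case: ifP => [/andP [? /eqP]|_ /eqP].
apply/ffunP => B; rewrite bE.
transitivity (\sum_A codiff (fun X => (X == B)%:R) A * (if inK A then b A else 0)).
  set b' : {ffun {set 'I_n} -> k} := finfun _.
  transitivity (\sum_X (X == B)%:R * boundary b' X).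
    rewrite (bigD1 B) //= eqxx mul1r big1 ?addr0 // => X /negPf ->.
    by rewrite mul0r.
  by rewrite -sum_codiff_boundary; apply: eq_bigr => A _; rewrite [b' A]ffunE.
by apply: eq_bigr => A _; rewrite /M; case: ifP; rewrite ?mulr0 // mulrC.
Qed.

(** * Cochains on a link as cochains supported on the faces containing G *)

Section Twist.
Variable G : {set 'I_n}.

(** For H disjoint from G this is (-1) to the number of pairs g < h with g in G and h in H, the sign
    of the shuffle of H and G. It absorbs the factor [sgn G h] by which the signs in [H :|: G] and
    in H differ. *)
Definition twist_sign H : k := \prod_(h in H) sgn k G h.

Lemma twist_sign_sqr H : twist_sign H * twist_sign H = 1.
Proof. by rewrite -big_split big1 //= => h _; rewrite sgn_sqr. Qed.

Definition to_link phi H : k := twist_sign H * phi (H :|: G).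

Definition of_link psi A : k :=
  if G \subset A then twist_sign (A :\: G) * psi (A :\: G) else 0.

Lemma setUGK H : [disjoint H & G] -> (H :|: G) :\: G = H.
Proof.
by move=> dHG; rewrite setDUl setDv setU0; apply/setDidPl.
Qed.

Lemma to_linkK psi H : [disjoint H & G] -> to_link (of_link psi) H = psi H.
Proof.
move=> dHG; rewrite /to_link /of_link subsetUr setUGK //.
by rewrite mulrA twist_sign_sqr mul1r.
Qed.

Lemma codiff_to_link phi H :
    (forall A, phi A != 0 -> G \subset A) -> [disjoint H & G] ->
  codiff phi (H :|: G) = twist_sign H * codiff (to_link phi) H.
Proof.
move=> supp dHG; rewrite /codiff big_distrr /=.
(* Removing a vertex of G leaves a set that does not contain G, where phi vanishes. *)
rewrite (bigID (mem H)) /= [X in _ + X]big1 ?addr0; last first.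
  move=> a; rewrite inE => /andP [aHG aH]; rewrite (negPf aH) /= in aHG.
  suff -> : phi ((H :|: G) :\ a) = 0 by rewrite mulr0.
  apply/eqP; apply: contraTT aHG => /supp /subsetP sG.
  by apply/negP => /sG; rewrite !inE eqxx.
apply: eq_big => [a|a /andP [_ aH]]; first by rewrite !inE; case: (a \in H); rewrite ?andbT ?andbF.
have aG : a \notin G by rewrite (disjointFr dHG aH).
rewrite (_ : (H :|: G) :\ a = (H :\ a) :|: G); last first.
  apply/setP=> b; rewrite !inE; case: eqP => [->|//]; by rewrite (negPf aG).
rewrite sgnU // /to_link /twist_sign (big_setD1 a aH) /=.
rewrite -/(twist_sign (H :\ a)) -[LHS]mul1r -(twist_sign_sqr (H :\ a)).
by ring.
Qed.

Lemma codiff_of_link psi H : [disjoint H & G] ->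
  codiff (of_link psi) (H :|: G) = twist_sign H * codiff psi H.
Proof.
move=> dHG; rewrite codiff_to_link //; last first.
  by move=> A; rewrite /of_link; case: ifP => // _ /eqP.
congr (_ * _); apply: eq_codiff => a aH; apply: to_linkK.
exact: disjointWl (subD1set _ _) dHG.
Qed.

Lemma in_link K H : simplicial_complex K ->
  (H \in link K G) = (H :|: G \in K) && [disjoint H & G].
Proof.
move=> hK; rewrite inE setI_eq0; case: (boolP (_ :|: _ \in K)) => [HG|]; last by rewrite andbF.
by rewrite (hK _ _ HG) // subsetUl.
Qed.

(* The grading is by the faces of K, hence shifted by #|G| with respect to the link of G. *)
Definition relative_cohomology_vanishes K i :=
  forall phi, (forall A, phi A != 0 -> G \subset A) ->
    (forall A, A \in K -> G \subset A -> #|A| = i.+1 -> codiff phi A = 0) ->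
  exists psi, (forall B, psi B != 0 -> (G \subset B) && (#|B|.+1 == i)) /\
    forall A, A \in K -> G \subset A -> #|A| = i -> phi A = codiff psi A.

Lemma card_setUG H : [disjoint H & G] -> #|H :|: G| = (#|H| + #|G|)%N.
Proof. by rewrite -(leq_card_setU H G).2 => /eqP. Qed.

Lemma setDUG A : G \subset A -> (A :\: G) :|: G = A /\ [disjoint A :\: G & G].
Proof.
move=> GA; split; last first.
  by rewrite disjoint_sym disjoints_subset; apply/subsetP=> b bG; rewrite !inE bG.
by rewrite setUC -[RHS](setID A G) (setIidPr GA).
Qed.

(** [to_link] and [of_link] are inverse to each other and commute with the coboundaries up to
    [twist_sign]; the rest is duality over k. *)
Lemma link_homology K c : simplicial_complex K ->
  reduced_homology_vanishes k (link K G) c <->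
  relative_cohomology_vanishes K (c + #|G|).
Proof.
move=> hK; split=> [hom phi supp cocyc | coh].
  have [H|psi [psupp psiE]] := cohomology_of_homology (phi := to_link phi) hom.
    rewrite in_link // => /andP [HG dHG] Hc.
    have := cocyc (H :|: G) HG (subsetUr _ _).
    rewrite codiff_to_link // card_setUG // Hc => /(_ erefl) e.
    by rewrite -[LHS]mul1r -(twist_sign_sqr H) -mulrA e mulr0.
  exists (of_link psi); split=> [B|A AK GA Ac].
    rewrite /of_link; case: ifP => [GB pB|_ /eqP //] /=.
    have [e d] := setDUG GB.
    rewrite -e card_setUG // -addSn (psupp (B :\: G)) //.
    by apply: contraNneq pB => ->; rewrite mulr0.
  have [e d] := setDUG GA; rewrite -{2}e codiff_of_link // -psiE.
  - by rewrite /to_link mulrA twist_sign_sqr mul1r e.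
  - by rewrite in_link // e AK.
  - by apply: (@addIn #|G|); rewrite -card_setUG // e.
apply: homology_of_cohomology => phi cocyc.
have [A|A AK GA Ac|psi [psupp psiE]] := coh (of_link phi).
- by rewrite /of_link; case: ifP => // _ /eqP.
- have [e d] := setDUG GA; rewrite -e codiff_of_link // cocyc ?mulr0 //.
    by rewrite in_link // e AK.
  by apply: (@addIn #|G|); rewrite -card_setUG // e Ac addSn.
exists (to_link psi) => H; rewrite in_link // => /andP [HG d] Hc.
have := psiE (H :|: G) HG (subsetUr _ _).
rewrite card_setUG // Hc codiff_to_link //; last by move=> A /psupp /andP [].
move=> /(_ erefl) e; rewrite -(to_linkK phi d) /to_link e.
by rewrite mulrA twist_sign_sqr mul1r.
Qed.

End Twist.
End Duality.

(** * The Buchsbaum condition *)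

Section Combinatorics.
Variables (k : fieldType) (n : nat) (Delta : {set {set 'I_n}}).
Hypothesis hDelta : simplicial_complex Delta.
Implicit Types (A B F G H V : {set 'I_n}).

(** For nonempty V this is the union of stars of the theorem. For empty V that union is void whereas
    [near_star] is Delta, so that the condition on Delta itself becomes the case V = [set0]. *)
Definition near_star V : {set {set 'I_n}} :=
  [set A : {set 'I_n} | [exists F in facets Delta, (A \subset F) && (#|V :\: F| <= 1)%N]].

Lemma near_starP V A :
  reflect (exists F, [/\ F \in facets Delta, A \subset F & (#|V :\: F| <= 1)%N])
          (A \in near_star V).
Proof.
rewrite inE; apply: (iffP exists_inP) => [[F fF /andP []]|[F [fF AF VF]]].
  by exists F.
by exists F; rewrite ?AF.
Qed.

Lemma facet_face F : F \in facets Delta -> F \in Delta.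
Proof. by rewrite inE => /maxsetP []. Qed.

Lemma facet_max F A : F \in facets Delta -> A \in Delta -> F \subset A -> A = F.
Proof. by rewrite inE => /maxsetP [_ mF] AD /(mF _ AD). Qed.

Lemma face_facet A : A \in Delta -> exists2 F, F \in facets Delta & A \subset F.
Proof.
move=> AD; have [F mF AF] := @maxset_exists _ (fun G => G \in Delta) A AD.
by exists F; rewrite ?inE.
Qed.

Lemma near_star_complex V : simplicial_complex (near_star V).
Proof.
move=> A B /near_starP [F [fF AF VF]] BA; apply/near_starP; exists F.
by rewrite (subset_trans BA).
Qed.

Lemma near_star_sub V A : A \in near_star V -> A \in Delta.
Proof. by move=> /near_starP [F [/facet_face fF AF _]]; apply: hDelta fF AF. Qed.

Lemma near_star0 : near_star set0 = Delta.
Proof.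
apply/setP=> A; apply/idP/idP; first exact: near_star_sub.
move=> /face_facet [F fF AF]; apply/near_starP; exists F.
by rewrite set0D cards0.
Qed.

Lemma near_star_bigcup V : V != set0 ->
  near_star V = \bigcup_(i in V) star Delta (V :\ i).
Proof.
move=> /set0Pn [i0 i0V]; apply/setP=> A; apply/near_starP/bigcupP.
  move=> [F [fF AF VF]].
  have [i iV sVF] : exists2 i, i \in V & V :\ i \subset F.
    (* If F contains V, any vertex of V will do; this is where V has to be nonempty. *)
    have [|] := boolP (V :\: F == set0).
      rewrite setD_eq0 => VsF; exists i0 => //.
      exact: subset_trans (subD1set _ _) VsF.
    move=> /set0Pn [i iVF]; exists i; first by move: iVF; rewrite inE => /andP [].
    move: VF; rewrite (cardsD1 i) iVF ltnS leqn0 cards_eq0 => /eqP e.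
    apply/subsetP=> b; rewrite !inE => /andP [bi bV].
    by have /setP/(_ b) := e; rewrite !inE bi bV andbT /= => /negbFE.
  exists i => //; rewrite inE (hDelta (facet_face fF) AF).
  by rewrite (hDelta (facet_face fF)) // subUset AF.
move=> [i iV]; rewrite inE => /andP [_ /face_facet [F fF]].
rewrite subUset => /andP [AF VF]; exists F; split => //.
rewrite (leq_trans (subset_leq_card (_ : _ \subset [set i]))) ?cards1 //.
apply/subsetP=> b; rewrite !inE => /andP [bF bV].
by apply: contraNT bF => bi; rewrite (subsetP VF) // !inE bi.
Qed.

(** The facets that matter contain G, so they miss the same vertices of V as of [V :\: G]. *)
Lemma link_near_star V G : link (near_star V) G = link (near_star (V :\: G)) G.
Proof.
apply/setP=> H; rewrite !in_link; try exact: near_star_complex.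
congr (_ && _); apply/near_starP/near_starP => -[F [fF HF VF]]; exists F; split => //;
  move: VF; rewrite setDDl (setUidPr _) //; exact: subset_trans (subsetUr _ _) HF.
Qed.


Lemma facet_dim F : F \in facets Delta -> (#|F| <= dim_succ Delta)%N.
Proof. by move=> /facet_face FD; apply: leq_bigmax_cond. Qed.

Lemma dim_succ_facet : (0 < dim_succ Delta)%N ->
  exists2 F, F \in facets Delta & #|F| = dim_succ Delta.
Proof.
move=> dpos; have [A0 A0D] : exists A, A \in Delta.
  by apply/set0Pn; apply: contraTneq dpos => D0; rewrite /dim_succ D0 big_set0.
have D0 : (0 < #|Delta|)%N by apply/card_gt0P; exists A0.
have [A AD eA] := eq_bigmax_cond (fun A : {set 'I_n} => #|A|) D0.
have [F fF AF] := face_facet AD; exists F => //.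
apply/eqP; rewrite eqn_leq facet_dim //= /dim_succ eA.
exact: subset_leq_card.
Qed.

(** The bound refers to the dimension of Delta because local cohomology is restricted by dim S/I. It
    agrees with the dimension of [near_star V] when Delta is pure and [near_star V] is not void. *)
Definition links_acyclic := forall G V c, G != set0 -> [disjoint G & V] ->
  (c + #|G| < dim_succ Delta)%N ->
  reduced_homology_vanishes k (link (near_star V) G) c.

Lemma pure_facet F : pure Delta -> F \in facets Delta -> #|F| = dim_succ Delta.
Proof.
move=> pD fF; have [d0|dpos] := posnP (dim_succ Delta).
  by apply/eqP; rewrite d0 -leqn0 -d0 facet_dim.
by have [F' fF' <-] := dim_succ_facet dpos; apply: pD.
Qed.

Lemma homology_link_notin K G c : simplicial_complex K -> G \notin K ->
  reduced_homology_vanishes k (link K G) c.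
Proof.
move=> hK GK z zchain _; suff -> : z = 0.
  exists 0; first by move=> A; rewrite ffunE eqxx.
  by apply/ffunP => A; rewrite !ffunE big1 // => a _; rewrite ffunE mulr0.
apply/ffunP => A; rewrite ffunE; apply/eqP; apply: contraNT GK => /zchain [].
by rewrite in_link // => /andP [AG _] _; apply: hK AG (subsetUr _ _).
Qed.

(** A facet F that is too small has link {[set0]}, whose reduced homology in degree -1 is k. This
    contradicts acyclicity for G = F, empty V and c = 0. *)
Lemma pure_of_acyclic : links_acyclic -> pure Delta.
Proof.
move=> acyc.
suff dimF F : F \in facets Delta -> #|F| = dim_succ Delta by move=> F G /dimF -> /dimF ->.
move=> fF; apply/eqP; rewrite eqn_leq facet_dim //= leqNgt; apply/negP => Fd.
(* G = F must be nonempty; an empty facet, however, is the only face and thus has maximal size. *)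
have [F0|Fn0] := eqVneq F set0.
  have [F' fF' F'd] := dim_succ_facet (leq_ltn_trans (leq0n _) Fd).
  move: Fd; rewrite -F'd (facet_max fF (facet_face fF')) ?ltnn //.
  by rewrite F0 sub0set.
have := acyc F set0 0%N Fn0; rewrite -setI_eq0 setI0 eqxx => /(_ isT Fd).
rewrite near_star0 => hom.
pose z : {ffun {set 'I_n} -> k} := [ffun A => (A == set0)%:R].
have link0 H : H \in link Delta F -> H = set0.
  rewrite in_link // => /andP [HF dHF].
  apply/eqP; rewrite -subset0 -(setUGK dHF).
  by rewrite (facet_max fF HF (subsetUr _ _)) setDv.
have [A||b bchain bz] := hom z.
- rewrite ffunE; case: (A =P set0) => [->|_]; last by rewrite eqxx.
  by rewrite cards0 in_link // set0U (facet_face fF) -setI_eq0 set0I eqxx.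
- apply/ffunP => A; rewrite !ffunE big1 // => a aA; rewrite ffunE.
  by rewrite (_ : _ == _ = false) ?mulr0 //; apply/set0Pn; exists a; rewrite !inE eqxx.
have : z set0 = 0.
  rewrite -bz ffunE big1 // => a _; have [->|/bchain []] := eqVneq (b (a |: set0)) 0.
    by rewrite mulr0.
  by move=> /link0 ->; rewrite cards0.
by rewrite ffunE eqxx => /eqP; rewrite oner_eq0.
Qed.

Lemma disjoint_setDr A B : [disjoint A & B :\: A].
Proof. by rewrite disjoints_subset; apply/subsetP=> b bA; rewrite !inE bA. Qed.

Lemma buchsbaum_near_star V : links_acyclic -> buchsbaum k (near_star V).
Proof.
move=> acyc; have pD := pure_of_acyclic acyc.
have facetG F : F \in facets (near_star V) -> F \in facets Delta.
  rewrite inE => /maxsetP [/near_starP [F' [fF' FF' VF']] mF].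
  by rewrite -(mF F') //; apply/near_starP; exists F'.
split=> [F F' /facetG fF /facetG fF' | G GV Gn0 c cG]; first exact: pD.
rewrite link_near_star; apply: acyc => //; first exact: disjoint_setDr.
apply: leq_trans cG _; apply/bigmax_leqP => A /near_star_sub AD.
exact: leq_bigmax_cond.
Qed.

Lemma buchsbaum_links_acyclic :
  (buchsbaum k Delta /\
   forall V : {set 'I_n}, (1 <= #|V| <= dim_succ Delta)%N ->
     buchsbaum k (\bigcup_(i in V) star Delta (V :\ i))) <-> links_acyclic.
Proof.
split=> [[[pD bD] bV] G V c Gn0 dGV cG | acyc]; last first.
  split; first by rewrite -near_star0; apply: buchsbaum_near_star.
  move=> V /andP [V1 _]; rewrite -near_star_bigcup; first exact: buchsbaum_near_star.
  by rewrite -card_gt0.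
have [GK|] := boolP (G \in near_star V); last first.
  by apply: homology_link_notin; apply: near_star_complex.
have [F [fF GF VF]] := near_starP _ _ GK.
have Fd := pure_facet pD fF.
have [V0|Vn0] := eqVneq V set0.
  by rewrite V0 near_star0; apply: bD => //; apply: near_star_sub GK.
(* F contains G and, disjointly from it, all of V but at most one vertex; the nonempty G makes up
   for the missing vertex. *)
have Vd : (#|V| <= dim_succ Delta)%N.
  rewrite -Fd leqNgt; apply/negP => FV.
  have : (#|G| + #|V :&: F| <= #|F|)%N.
    have dG : [disjoint G & V :&: F] by apply: disjointWr (subsetIl _ _) dGV.
    rewrite -card_setUG // subset_leq_card // subUset GF; exact: subsetIr.
  move: FV; rewrite -(cardsID F V) => FV.
  have G1 : (0 < #|G|)%N by rewrite card_gt0.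
  by rewrite leqNgt (leq_trans FV) // addnC leq_add // (leq_trans VF).
have [_] : buchsbaum k (near_star V).
  by rewrite near_star_bigcup //; apply: bV; rewrite Vd card_gt0 Vn0.
(* By purity the facet F, a face of [near_star V], already has the maximal size in Delta, so the
   range of c is the same. *)
apply=> //; apply: leq_trans cG _; rewrite -Fd.
apply: leq_bigmax_cond; apply/near_starP; by exists F.
Qed.

End Combinatorics.

(** * Krull dimension *)

Section Ideals.
Variable R : comNzRingType.
Implicit Types (J P : R -> Prop).

Lemma ideal_sum J (I : Type) (r : seq I) (Q : pred I) (f : I -> R) : is_ideal J ->
  (forall i, Q i -> J (f i)) -> J (\sum_(i <- r | Q i) f i).
Proof. by move=> [J0 JD _] Jf; apply: big_ind. Qed.

Lemma ideal_mulr J f g : is_ideal J -> J f -> J (f * g).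
Proof. by move=> [_ _ JM] Jf; rewrite mulrC; apply: JM. Qed.

Lemma ideal_gen_ideal (G : R -> Prop) : is_ideal (ideal_gen G).
Proof.
split=> [|f g [s sG ->] [t tG ->]|p f [s sG ->]].
- by exists [::]; rewrite ?big_nil.
- exists (s ++ t); last by rewrite big_cat.
  by move=> pg; rewrite mem_cat => /orP [/sG|/tG].
- exists [seq (p * pg.1, pg.2) | pg <- s].
    by move=> pg /mapP [qg /sG Gq ->].
  by rewrite big_map big_distrr; apply: eq_bigr => i _; rewrite /= mulrA.
Qed.

Lemma ideal_gen_min (G J : R -> Prop) : is_ideal J -> (forall g, G g -> J g) ->
  forall f, ideal_gen G f -> J f.
Proof.
move=> iJ GJ f [s sG ->]; rewrite big_seq; apply: ideal_sum => // pg /sG /GJ.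
by case: iJ => _ _; apply.
Qed.

Lemma ideal_gen_in (G : R -> Prop) g : G g -> ideal_gen G g.
Proof.
by move=> Gg; exists [:: (1, g)]; rewrite ?big_seq1 ?mul1r // => pg; rewrite inE => /eqP ->.
Qed.

Lemma prime_prod P (I : Type) (r : seq I) (Q : pred I) (f : I -> R) : is_prime_ideal P ->
  (forall i, Q i -> ~ P (f i)) -> ~ P (\prod_(i <- r | Q i) f i).
Proof.
move=> [_ P1 PM] nPf; apply: (big_ind (fun x => ~ P x)) => // x y nx ny.
by move=> /PM [].
Qed.

Lemma prime_expM P y z a : is_prime_ideal P -> ~ P y -> P (y ^+ a * z) -> P z.
Proof.
move=> [_ _ PM] nPy; elim: a => [|a IH]; first by rewrite mul1r.
by rewrite exprS -mulrA => /PM [].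
Qed.

Lemma kernel_prime (A : idomainType) (f : {rmorphism R -> A}) :
  is_prime_ideal (fun x => f x = 0).
Proof.
split=> [||x y].
- split=> [|x y fx fy|p x fx]; first by rewrite rmorph0.
    by rewrite rmorphD fx fy addr0.
  by rewrite rmorphM fx mulr0.
- by rewrite rmorph1; apply/eqP/oner_neq0.
- by rewrite rmorphM => /eqP; rewrite mulf_eq0 => /orP [] /eqP; [left | right].
Qed.

End Ideals.

(** * Algebraic relations between polynomials and chains of primes *)

Section Relations.
Variables (k : fieldType) (n : nat).
Local Notation S := {mpoly k[n]}.

(* The exponent of each variable is less than N, and c maps a list of exponents
   to the coefficient of the corresponding monomial. *)
Fixpoint poly_value N (ys : seq S) (c : seq nat -> k) : S :=
  if ys is y :: ys' then
    \sum_(a < N) y ^+ a * poly_value N ys' (fun s => c (val a :: s))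
  else (c [::])%:MP.

Lemma poly_value_eq0 N ys c :
  (forall s : (size ys).-tuple 'I_N, c (map val s) = 0) -> poly_value N ys c = 0.
Proof.
elim: ys c => [|y ys IH] c c0 /=; first by rewrite (c0 [tuple]) mpolyC0.
rewrite big1 // => a _; rewrite IH ?mulr0 // => s.
exact: (c0 [tuple of a :: s]).
Qed.

Lemma poly_value_sum N ys (T : finType) (v : T -> k) (c : T -> seq nat -> k) :
  poly_value N ys (fun s => \sum_t v t * c t s) =
  \sum_t v t *: poly_value N ys (c t).
Proof.
elim: ys c => [|y ys IH] c /=.
  rewrite raddf_sum; apply: eq_bigr => t _.
  by rewrite /= -mul_mpolyC -mpolyCM.
under eq_bigr do rewrite IH big_distrr.
rewrite exchange_big; apply: eq_bigr => t _; rewrite scaler_sumr.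
by apply: eq_bigr => a _; rewrite /= scalerAr.
Qed.

(** [msize] is the degree plus one, but 0 for the zero polynomial; bounding it by a successor makes
    degrees additive without that exception. *)
Lemma msize_mulS p q a b : (msize p <= a.+1)%N -> (msize q <= b.+1)%N ->
  (msize (p * q : S) <= (a + b).+1)%N.
Proof.
move=> pa qb; have [->|p0] := eqVneq p 0; first by rewrite mul0r msize0.
have [->|q0] := eqVneq q 0; first by rewrite mulr0 msize0.
rewrite msizeM // -subn1 leq_subLR (leq_trans (leq_add pa qb)) //.
by rewrite addSn addnS.
Qed.

Lemma msize_expS p a b : (msize (p : S) <= a.+1)%N -> (msize (p ^+ b) <= (b * a).+1)%N.
Proof.
move=> pa; elim: b => [|b IH]; first by rewrite expr0 msize1.
by rewrite exprS mulSn; apply: msize_mulS.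
Qed.

Lemma msize_poly_value N ys c D : (forall y, y \in ys -> (msize y <= D.+1)%N) ->
  (msize (poly_value N ys c) <= (size ys * (N * D)).+1)%N.
Proof.
elim: ys c => [|y ys IH] c ysD /=.
  by rewrite msizeC; case: (_ != _).
apply: (leq_trans (msize_sum _ _ _)); apply/bigmax_leqP => a _.
apply: leq_trans (_ : (a * D + size ys * (N * D)).+1 <= _)%N.
  apply: msize_mulS; last by apply: IH => z zs; rewrite ysD // inE zs orbT.
  by apply: msize_expS; rewrite ysD // inE eqxx.
by rewrite ltnS mulSn leq_add2r leq_mul2r ltnW ?orbT.
Qed.

Lemma poly_value_rmorph N ys c (f : {rmorphism S -> S}) : (forall c : k, f c%:MP = c%:MP) ->
  f (poly_value N ys c) = poly_value N (map f ys) c.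
Proof.
move=> fC; elim: ys c => [|y ys IH] c /=; first exact: fC.
by rewrite rmorph_sum; apply: eq_bigr => a _; rewrite rmorphM rmorphXn IH.
Qed.

(* Coquand and Lombardi: a nontrivial relation between the y_j, sorted by its
   lowest power of y_0, yields a nontrivial relation between y_1, y_2 and so on
   modulo P_1, and in the end a nonzero constant in the last prime. *)
Lemma prime_chain_no_relation N ys : forall (P : nat -> S -> Prop) c,
  (forall j, (j <= size ys)%N -> is_prime_ideal (P j)) ->
  (forall j, (j < size ys)%N ->
     [/\ forall f, P j f -> P j.+1 f, ~ P j ys`_j & P j.+1 ys`_j]) ->
  (exists s : (size ys).-tuple 'I_N, c (map val s) != 0) ->
  ~ P 0%N (poly_value N ys c).
Proof.
elim: ys => [|y ys IH] P c primeP chainP [s sc].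
  move: sc; rewrite tuple0 /= => c0 Pc.
  have [[_ _ PM] P1 _] := primeP 0%N isT; apply: P1.
  have -> : 1 = ((c [::])^-1)%:MP * (c [::])%:MP :> S by rewrite -mpolyCM mulVf.
  exact: PM.
pose Q a := [exists s : (size ys).-tuple 'I_N, c (a :: map val s) != 0].
have [a0 Qa0 mina0] : exists2 a0, (a0 < N)%N && Q a0 & forall a, Q a -> (a0 <= a)%N.
  have exQ : exists a, (a < N)%N && Q a.
    move: sc; case/tupleP: s => a s sc; exists a; rewrite ltn_ord; apply/existsP.
    by exists s.
  case: (ex_minnP exQ) => a0 /[dup] /andP [a0N _] Qa0 mina0; exists a0 => // a Qa.
  have [aN|] := ltnP a N; first by apply: mina0; rewrite aN.
  by apply: leq_trans; apply: ltnW.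
move: Qa0 => /andP [a0N Qa0] /=; set e := fun a => poly_value N ys (fun s => c (a :: s)).
have e0 a : (a < a0)%N -> e a = 0.
  move=> aa0; apply: poly_value_eq0 => s'; apply/eqP; apply/negPn/negP => sc'.
  by have := mina0 a; rewrite leqNgt aa0 => /(_ _)/negP; apply => //; apply/existsP; exists s'.
have [inc0 ny0 y1] := chainP 0%N isT.
have P0p := primeP 0%N isT; have [[_ PD PM] _ _] := primeP 1%N isT.
rewrite -(big_mkord predT (fun a => y ^+ a * e a)) (big_cat_nat (n := a0)) //=; last exact: ltnW.
rewrite big_nat_cond big1 ?add0r => [|a]; last first.
  by rewrite andbT => /andP [_ /e0 ->]; rewrite mulr0.
(* As y is outside [P 0], the power of y can be cancelled; as y lies in [P 1], only [e a0] is left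
   modulo [P 1]. *)
have -> : \sum_(a0 <= a < N) y ^+ a * e a =
    y ^+ a0 * (e a0 + y * \sum_(a0.+1 <= a < N) y ^+ (a - a0.+1) * e a).
  rewrite big_ltn // mulrDr mulrA -exprSr big_distrr; congr (_ + _).
  rewrite big_nat_cond [RHS]big_nat_cond; apply: eq_bigr => a; rewrite andbT => /andP [a0a _].
  by rewrite /= mulrA -exprD subnKC.
move=> /(prime_expM P0p ny0) /inc0 P1.
apply: (IH (fun j => P j.+1) (fun s => c (a0 :: s))).
- by move=> j jys; apply: primeP.
- by move=> j jys; apply: (chainP j.+1).
- by move/existsP: Qa0.
rewrite -/(e a0); have -> : e a0 = (e a0 + y * (\sum_(a0.+1 <= a < N) y ^+ (a - a0.+1) * e a)) +
   (- \sum_(a0.+1 <= a < N) y ^+ (a - a0.+1) * e a) * y by ring.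
by apply: PD => //; apply: PM.
Qed.

Section Restriction.
Variable F : {set 'I_n}.

(** The projection of S onto S/P_F, identified with the polynomials in the variables of F so that it
    becomes an endomorphism of S. Its kernel is P_F. *)
Definition restrict_vars (f : S) : S :=
  f \mPo [tuple if i \in F then 'X_i else 0 | i < n].

HB.instance Definition _ := GRing.RMorphism.copy restrict_vars
  (comp_mpoly [tuple if i \in F then 'X_i else 0 | i < n]).

Lemma restrict_varsX i : restrict_vars 'X_i = if i \in F then 'X_i else 0.
Proof. by rewrite /restrict_vars comp_mpolyXU -tnth_nth tnth_mktuple. Qed.

Lemma restrict_varsC c : restrict_vars c%:MP = c%:MP.
Proof. exact: comp_mpolyC. Qed.

Lemma restrict_varsZ c f : restrict_vars (c *: f) = c *: restrict_vars f.
Proof. exact: comp_mpolyZ. Qed.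

Lemma restrict_varsXm m :
  restrict_vars 'X_[m] = if [forall i, (i \notin F) ==> (m i == 0%N)] then 'X_[m] else 0.
Proof.
rewrite /restrict_vars comp_mpolyX; case: forallP => [mF|].
  rewrite mpolyXE_id; apply: eq_bigr => i _; rewrite tnth_mktuple.
  by case: ifP (mF i) => //= _ /eqP ->.
move=> /forallP; rewrite negb_forall => /existsP [i]; rewrite negb_imply => /andP [iF mi].
by rewrite (bigD1 i) //= tnth_mktuple (negPf iF) expr0n (negPf mi) mul0r.
Qed.

Lemma msupp_restrict_vars f m i : m \in msupp (restrict_vars f) -> i \notin F -> m i = 0%N.
Proof.
rewrite mcoeff_msupp => mf iF; apply/eqP; apply: contraNT mf => mi.
rewrite [f]mpolyE rmorph_sum raddf_sum big1 //= => m' _.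
rewrite restrict_varsZ restrict_varsXm mcoeffZ.
case: forallP => [/(_ i)|]; last by rewrite mcoeff0 mulr0.
by rewrite iF mcoeffX; case: (eqVneq m' m) mi => [->|]; [case: eqP | rewrite mulr0].
Qed.

(** The terms of f that are changed are those divisible by a variable outside F. *)
Lemma restrict_vars_congr (P : S -> Prop) f : is_ideal P ->
  (forall i, i \notin F -> P 'X_i) -> P (f - restrict_vars f).
Proof.
move=> iP PX; rewrite {2}[f]mpolyE {1}[f]mpolyE [restrict_vars _]rmorph_sum -sumrB.
apply: ideal_sum => // m _.
rewrite /= restrict_varsZ -scalerBr -mul_mpolyC.
have [iP0 _ PM] := iP; apply: (PM).
rewrite restrict_varsXm; case: forallP; first by rewrite subrr.
move=> /forallP; rewrite negb_forall => /existsP [i]; rewrite negb_imply => /andP [iF mi].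
rewrite subr0 -(@submK _ U_(i)%MM m) ?lep1mP // mpolyXD.
by apply: PM; apply: PX.
Qed.

(* Counting: N ^ size ys monomials in the ys, whose values lie in a space of
   dimension O(N ^ #|F|). *)
Lemma algebraic_dependence ys : (#|F| < size ys)%N ->
  exists N c, (exists s : (size ys).-tuple 'I_N, c (map val s) != 0) /\
    restrict_vars (poly_value N ys c) = 0.
Proof.
move=> Fys; set e := #|F|.
pose D := \max_(y <- map restrict_vars ys) msize y.
(* M bounds the degrees of the values, and M + 1 <= N * C. The choice of N gives (N * C) ^ e < N ^
   (e + 1) <= N ^ [size ys], more monomials in the ys than coefficients to kill. *)
pose C := (size ys * D).+1; pose N := (C ^ e).+1; pose M := (size ys * (N * D))%N.
pose T := (size ys).-tuple 'I_N.
pose B := {ffun {i | i \in F} -> 'I_M.+1}.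
pose mon (b : B) : 'X_{1..n} := [multinom if insub i is Some j then val (b j) else 0%N | i < n].
pose c0 (t : T) (s : seq nat) : k := (s == map val t)%:R.
have [|v [[t vt] vrel]] := @linear_relation k T B
    (fun t b => (restrict_vars (poly_value N ys (c0 t)))@_(mon b)).
  have cF : #|{: {i | i \in F}}| = e by rewrite card_sig; apply: eq_card.
  rewrite card_tuple card_ffun cF !card_ord.
  apply: (@leq_ltn_trans (N ^ e * C ^ e)%N).
    have [->//|epos] := posnP e.
    rewrite -expnMn leq_exp2r // /C mulnS mulnCA -/M -[M.+1]add1n.
    by rewrite leq_add.
  rewrite (leq_trans (n := N ^ e.+1)) ?leq_pexp2l //.
  by rewrite expnSr ltn_pmul2l ?expn_gt0.
exists N, (fun s => \sum_t v t * c0 t s); split.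
  exists t; rewrite (bigD1 t) //= /c0 eqxx mulr1 big1 ?addr0 // => t' /negPf tt'.
  rewrite inj_eq ?mulr0; last by apply: inj_map; apply: val_inj.
  by rewrite (inj_eq val_inj) eq_sym tt' mulr0.
set f := restrict_vars _.
have coef0 b : f@_(mon b) = 0.
  rewrite -[RHS](vrel b) /f poly_value_sum rmorph_sum raddf_sum; apply: eq_bigr => t' _ /=.
  by rewrite restrict_varsZ mcoeffZ.
apply/mpolyP => m; rewrite mcoeff0; apply/eqP; apply/negPn/negP; rewrite -mcoeff_msupp => mf.
have mM i : (m i < M.+1)%N.
  rewrite ltnS (leq_trans (n := mdeg m)) //.
    by rewrite mdegE (bigD1 i) //= leq_addr.
  rewrite -ltnS (leq_trans (msize_mdeg_lt mf)) // /f poly_value_rmorph; last exact: restrict_varsC.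
  rewrite (leq_trans (msize_poly_value (D := D) _ _ _)) ?size_map // => y ysy.
  by rewrite ltnW // ltnS; apply: leq_bigmax_seq.
pose b : B := [ffun i => inord (m (val i))].
have mb : m = mon b.
  apply/mnmP => i; rewrite mnmE; case: insubP => [j iF jE | iF].
    by rewrite /b ffunE jE /= inordK.
  exact: msupp_restrict_vars mf iF.
by move: mf; rewrite mcoeff_msupp mb coef0 eqxx.
Qed.

End Restriction.
End Relations.

(** * The dimension of S modulo the second symbolic power *)

Section Dimension.
Variables (k : fieldType) (n : nat) (Delta : {set {set 'I_n}}).
Local Notation S := {mpoly k[n]}.
Local Notation I := (symbolic_square (k := k) Delta).

Lemma symbolic_square_ideal : is_ideal I.
Proof.
have iI F := @ideal_gen_ideal S (fun h => exists f g,
  [/\ face_ideal (k := k) F f, face_ideal (k := k) F g & h = f * g]).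
split=> [F _|f g If Ig F fF|p f If F fF]; have [J0 JD JM] := iI F => //.
  by apply: JD; [apply: If | apply: Ig].
by apply: JM; apply: If.
Qed.

Lemma krull_dim_ge_facet F i : F \in facets Delta -> (i <= #|F|)%N -> krull_dim_ge I i.
Proof.
(* The sets lose one vertex at each step, so the kernels, which are the primes P_(F_j), gain one
   variable. All of them contain P_F, hence I. *)
move=> fF iF; pose Fj j := [set x in take (i - j) (enum F)].
pose P j f := restrict_vars (k := k) (Fj j) f = 0.
have primeP j : is_prime_ideal (P j) := kernel_prime _.
exists P; split=> [j ji|j ji].
  split=> // f /(_ _ fF); apply: ideal_gen_min; first by case: (primeP j).
  move=> _ [g [h [_ h2 ->]]]; have [[_ _ PM] _ _] := primeP j; apply: (PM).
  move: h2; apply: ideal_gen_min; first by case: (primeP j).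
  move=> _ [l lF ->]; rewrite /P restrict_varsX; case: ifP => //.
  by rewrite inE => /mem_take; rewrite mem_enum (negPf lF).
have [x0 _] : exists x0, x0 \in F by apply/card_gt0P/(leq_ltn_trans _ (leq_trans ji iF)).
have iE : (i - j = (i - j.+1).+1)%N by rewrite subnSK.
have lt : (i - j.+1 < size (enum F))%N by rewrite -cardE -iE (leq_trans _ iF) // leq_subr.
split=> [f f0|].
  rewrite -[f]subr0 -f0; apply: restrict_vars_congr; first by case: (primeP j.+1).
  move=> x; rewrite /P restrict_varsX !inE iE (take_nth x0) // mem_rcons inE.
  by rewrite negb_or => /andP [_ /negPf ->].
exists 'X_(nth x0 (enum F) (i - j.+1)); rewrite /P restrict_varsX.
  case: ifP => //; rewrite inE => h.
  have := enum_uniq F; rewrite -(cat_take_drop (i - j.+1).+1 (enum F)) cat_uniq (take_nth x0) //.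
  by rewrite rcons_uniq h.
rewrite inE iE (take_nth x0) // mem_rcons inE eqxx.
by apply/eqP; rewrite -msize_poly_eq0 msizeX mdeg1.
Qed.

(** Otherwise each facet F has a variable outside F that P misses. The product of the squares of
    these variables lies in I but not in P. *)
Lemma prime_contains_face_ideal (P : S -> Prop) : is_prime_ideal P -> (forall f, I f -> P f) ->
  exists2 F, F \in facets Delta & forall j, j \notin F -> P 'X_j.
Proof.
move=> primeP IP; apply: NNPP => noF.
have [f fP] : exists f : {set 'I_n} -> S, forall F, ~ P (f F) /\
    (F \in facets Delta -> ideal_mul (face_ideal (k := k) F) (face_ideal (k := k) F) (f F)).
  apply: (@fin_all_exists _ (fun=> S) (fun F f => ~ P f /\ (F \in facets Delta ->
    ideal_mul (face_ideal (k := k) F) (face_ideal (k := k) F) f))) => F; have [fF|nfF] := boolP (F \in facets Delta); last first.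
    by exists 1; case: primeP.
  have [j jF nPj] : exists2 j, j \notin F & ~ P 'X_j.
    apply: NNPP => noj; apply: noF; exists F => // j jF.
    by apply: NNPP => nPj; apply: noj; exists j.
  exists ('X_j * 'X_j); split.
    by case: primeP => _ _ PM /PM [].
  move=> _; apply: ideal_gen_in; exists 'X_j, 'X_j.
  by split=> //; apply: ideal_gen_in; exists j.
apply: (@prime_prod _ P _ (index_enum _) (mem (facets Delta)) f) => //.
  by move=> F _; case: (fP F).
apply: IP => F fF; rewrite (bigD1 F) //=; apply: ideal_mulr; first exact: ideal_gen_ideal.
by case: (fP F) => _; apply.
Qed.

(** The first prime contains some P_F. Choosing y_j in the prime j + 1 but not in the prime j, more
    than |F| of them would satisfy a relation modulo P_F, which the chain forbids. *)
Lemma krull_dim_symbolic_square m : krull_dim_ge I m -> (m <= dim_succ Delta)%N.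
Proof.
move=> [P [primeP chainP]].
have [primeP0 IP0] := primeP 0%N isT.
have [F fF FP] := prime_contains_face_ideal primeP0 IP0.
apply: leq_trans (facet_dim fF); rewrite leqNgt; apply/negP => Fm.
pose y j := epsilon (inhabits (0 : S)) (fun f => P j.+1 f /\ ~ P j f).
have yP j : (j < m)%N -> P j.+1 (y j) /\ ~ P j (y j).
  move=> /chainP [_ [f fP nfP]].
  exact: (epsilon_spec _ _ (ex_intro (fun f => P j.+1 f /\ ~ P j f) f (conj fP nfP))).
have [|N [c [cn0 rel]]] := @algebraic_dependence k n F (mkseq y m); first by rewrite size_mkseq.
have := @prime_chain_no_relation k n N (mkseq y m) P c; rewrite size_mkseq; apply.
- by move=> j /primeP [].
- move=> j jm; have [Pj nPj] := yP j jm; rewrite nth_mkseq //; split=> //.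
  by case: (chainP j jm).
- by move: cn0; rewrite size_mkseq.
have := @restrict_vars_congr k n F (P 0%N) (poly_value N (mkseq y m) c).
by rewrite rel subr0; apply => //; case: primeP0.
Qed.

End Dimension.

(** * Laurent coefficients *)

Lemma int_add_abs_ge0 (x : int) : 0 <= x + (absz x)%:Z.
Proof. by rewrite -lerBlDl sub0r abszE -normrN ler_norm. Qed.

Section Laurent.
Variables (k : fieldType) (n : nat).
Local Notation S := {mpoly k[n]}.
Local Notation K := {fraction S}.
Local Notation degree := {ffun 'I_n -> int}.
Implicit Types (a b : degree) (r : seq (k * degree)) (q : K).

Definition xpow a : K := \prod_j tofrac ('X_j : S) ^ a j.

Definition const (c : k) : K := tofrac (c%:MP_[n]).

HB.instance Definition _ := GRing.RMorphism.copy const (@tofrac S \o @mpolyC n k).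

Definition mdegree (m : 'X_{1..n}) : degree := [ffun j => (m j)%:Z].

Lemma tofracX_neq0 (j : 'I_n) : tofrac ('X_j : S) != 0.
Proof. by rewrite tofrac_eq0 -msize_poly_eq0 msizeX mdeg1. Qed.

Lemma xpowD a b : xpow (a + b) = xpow a * xpow b.
Proof.
by rewrite /xpow -big_split; apply: eq_bigr => j _; rewrite ffunE expfzDr ?tofracX_neq0.
Qed.

Lemma xpow_neq0 a : xpow a != 0.
Proof. by apply/prodf_neq0 => j _; rewrite expfz_neq0 ?tofracX_neq0. Qed.

Lemma xpow_mdegree m : xpow (mdegree m) = tofrac 'X_[m].
Proof.
rewrite mpolyXE_id rmorph_prod; apply: eq_bigr => j _.
by rewrite ffunE rmorphXn.
Qed.

(** Degrees may repeat in r, so that addition is concatenation; a coefficient is therefore a sum. *)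
Definition laurent r : K := \sum_(p <- r) const p.1 * xpow p.2.

Definition coef_laurent r a : k := \sum_(p <- r | p.2 == a) p.1.

Lemma laurent_eq0 r a : laurent r = 0 -> coef_laurent r a = 0.
Proof.
move=> r0; have [/mapP [p0 p0r ->]|ar] := boolP (a \in map snd r); last first.
  rewrite /coef_laurent big_seq_cond big1 // => p /andP [pr /eqP pa].
  by move: ar; rewrite -pa map_f.
(* Multiplying by x^m makes all exponents in r nonnegative and reduces the claim to polynomials. *)
pose m : 'X_{1..n} := [multinom (\sum_(p <- r) absz (p.2 j))%N | j < n].
pose mu b : 'X_{1..n} := [multinom absz ((b + mdegree m)%R j) | j < n].
have muE p : p \in r -> mdegree (mu p.2) = p.2 + mdegree m.
  move=> pr; apply/ffunP => j; rewrite ffunE mnmE gez0_abs // !ffunE mnmE.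
  rewrite (big_rem _ pr) PoszD addrA /=.
  by apply: (addr_ge0 (x := p.2 j + _)); rewrite ?int_add_abs_ge0.
have /eqP : laurent r * xpow (mdegree m) = 0 by rewrite r0 mul0r.
have -> : laurent r * xpow (mdegree m) = tofrac (\sum_(p <- r) p.1 *: 'X_[mu p.2]).
  rewrite rmorph_sum /laurent big_distrl /= big_seq [RHS]big_seq; apply: eq_bigr => p pr.
  by rewrite -mulrA -xpowD -muE // xpow_mdegree -mul_mpolyC rmorphM.
rewrite tofrac_eq0 => /eqP /(congr1 (mcoeff (mu p0.2))); rewrite raddf_sum mcoeff0 => e.
rewrite -[RHS]e /coef_laurent big_mkcond big_seq [RHS]big_seq; apply: eq_bigr => p pr /=.
rewrite mcoeffZ mcoeffX; have -> : (mu p.2 == mu p0.2) = (p.2 == p0.2).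
  apply/eqP/eqP => [/(congr1 mdegree)|-> //]; rewrite !muE //; exact: addIr.
by case: eqP; rewrite ?mulr1 ?mulr0.
Qed.

Definition is_laurent q := exists r, q = laurent r.

(** The coefficient is taken from an arbitrary Laurent representation of q, on which it does not
    depend by [laurent_eq0]; a fraction without such a representation gets an unspecified value. *)
Definition lcoef q a : k :=
  epsilon (inhabits 0) (fun c => exists2 r, q = laurent r & c = coef_laurent r a).

Lemma laurent_cat r r' : laurent (r ++ r') = laurent r + laurent r'.
Proof. by rewrite /laurent big_cat. Qed.

Lemma coef_laurent_cat r r' a :
  coef_laurent (r ++ r') a = coef_laurent r a + coef_laurent r' a.
Proof. by rewrite /coef_laurent big_cat. Qed.

Definition scale_laurent (c : k) b r := [seq (c * p.1, b + p.2) | p <- r].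

Lemma laurent_scale c b r :
  laurent (scale_laurent c b r) = const c * xpow b * laurent r.
Proof.
rewrite /laurent big_map big_distrr; apply: eq_bigr => p _ /=.
by rewrite rmorphM xpowD /=; ring.
Qed.

Lemma coef_laurent_scale c b r a :
  coef_laurent (scale_laurent c b r) a = c * coef_laurent r (a - b).
Proof.
rewrite /coef_laurent big_map big_distrr; apply: eq_bigl => p /=.
by rewrite [RHS]eq_sym subr_eq addrC eq_sym.
Qed.

Lemma xpow0 : xpow 0 = 1.
Proof. by rewrite /xpow big1 // => j _; rewrite ffunE expr0z. Qed.

Lemma lcoefE r a : lcoef (laurent r) a = coef_laurent r a.
Proof.
rewrite /lcoef; set Q := fun c => _.
have [r' e ->] : Q (epsilon (inhabits 0) Q).
  by apply: epsilon_spec; exists (coef_laurent r a), r.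
apply/eqP; rewrite -subr_eq0; apply/eqP.
rewrite -(laurent_eq0 (r := r' ++ scale_laurent (-1) 0 r) a).
  by rewrite coef_laurent_cat coef_laurent_scale subr0 mulN1r.
by rewrite laurent_cat laurent_scale -e xpow0 mulr1 rmorphN1 mulN1r subrr.
Qed.

Lemma is_laurent0 : is_laurent 0.
Proof. by exists [::]; rewrite /laurent big_nil. Qed.

Lemma is_laurentD q q' : is_laurent q -> is_laurent q' -> is_laurent (q + q').
Proof. by move=> [r ->] [r' ->]; exists (r ++ r'); rewrite laurent_cat. Qed.

Lemma is_laurentZ c b q : is_laurent q -> is_laurent (const c * xpow b * q).
Proof. by move=> [r ->]; exists (scale_laurent c b r); rewrite laurent_scale. Qed.

Lemma lcoef0 a : lcoef 0 a = 0.
Proof.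
have -> : 0 = laurent [::] by rewrite /laurent big_nil.
by rewrite lcoefE /coef_laurent big_nil.
Qed.

Lemma lcoefD q q' a : is_laurent q -> is_laurent q' ->
  lcoef (q + q') a = lcoef q a + lcoef q' a.
Proof. by move=> [r ->] [r' ->]; rewrite -laurent_cat !lcoefE coef_laurent_cat. Qed.

Lemma lcoefZX c b q a : is_laurent q ->
  lcoef (const c * xpow b * q) a = c * lcoef q (a - b).
Proof. by move=> [r ->]; rewrite -laurent_scale !lcoefE coef_laurent_scale. Qed.

Lemma lcoefZ c q a : is_laurent q -> lcoef (const c * q) a = c * lcoef q a.
Proof. by move=> lq; have := lcoefZX c 0 a lq; rewrite xpow0 mulr1 subr0. Qed.

Lemma is_laurentC c q : is_laurent q -> is_laurent (const c * q).
Proof. by move=> lq; have := is_laurentZ c 0 lq; rewrite xpow0 mulr1. Qed.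

Lemma is_laurent_sum (I : Type) (s : seq I) (P : pred I) (q : I -> K) :
  (forall i, P i -> is_laurent (q i)) -> is_laurent (\sum_(i <- s | P i) q i).
Proof. by move=> lq; apply: big_ind => //; [apply: is_laurent0 | apply: is_laurentD]. Qed.

Lemma lcoef_sum (I : Type) (s : seq I) (P : pred I) (q : I -> K) a :
  (forall i, P i -> is_laurent (q i)) ->
  lcoef (\sum_(i <- s | P i) q i) a = \sum_(i <- s | P i) lcoef (q i) a.
Proof.
move=> lq; elim: s => [|i s IH]; first by rewrite !big_nil lcoef0.
rewrite !big_cons; case: ifP => // Pi.
by rewrite lcoefD ?IH //; [apply: lq | apply: is_laurent_sum].
Qed.

Lemma lcoef_monomial c b a : lcoef (const c * xpow b) a = if b == a then c else 0.
Proof.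
have -> : const c * xpow b = laurent [:: (c, b)] by rewrite /laurent big_seq1.
by rewrite lcoefE /coef_laurent big_mkcond big_seq1.
Qed.

(** s may exceed the support, so that a single list serves all members of a Cech family. *)
Lemma laurent_expansion r (s : seq degree) : uniq s -> {subset map snd r <= s} ->
  laurent r = \sum_(a <- s) const (lcoef (laurent r) a) * xpow a.
Proof.
move=> us rs; transitivity (\sum_(a <- s) \sum_(p <- r | p.2 == a) const p.1 * xpow p.2).
  rewrite (exchange_big_dep predT) //= /laurent [LHS]big_seq [RHS]big_seq.
  apply: eq_bigr => p pr; rewrite -big_filter.
  rewrite (_ : [seq _ <- s | _] = [:: p.2]) ?big_seq1 //.
  under eq_filter do rewrite eq_sym.
  by apply: filter_pred1_uniq => //; apply: rs; apply: map_f.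
apply: eq_bigr => a _; rewrite lcoefE /coef_laurent rmorph_sum big_distrl /=.
by apply: eq_bigr => p /eqP ->.
Qed.

Definition mpoly_laurent (f : S) := [seq (f@_m, mdegree m) | m <- msupp f].

Lemma laurent_mpoly f : laurent (mpoly_laurent f) = tofrac f.
Proof.
rewrite /laurent big_map [in RHS](mpolyE f) rmorph_sum; apply: eq_bigr => m _ /=.
by rewrite xpow_mdegree -mul_mpolyC rmorphM.
Qed.

Definition cone_degree (A : {set 'I_n}) t : degree := [ffun j => if j \in A then t%:Z else 0].

Lemma xpow_cone A t : xpow (cone_degree A t) = tofrac (\prod_(j in A) ('X_j : S)) ^+ t.
Proof.
rewrite rmorph_prod -prodrXl [RHS]big_mkcond; apply: eq_bigr => j _.
by rewrite ffunE; case: ifP; rewrite ?expr0z.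
Qed.

Lemma prodX_neq0 (A : {set 'I_n}) : tofrac (\prod_(j in A) ('X_j : S)) != 0.
Proof. by rewrite rmorph_prod; apply/prodf_neq0 => j _; apply: tofracX_neq0. Qed.

Lemma loc_ideal_laurent (J : S -> Prop) A q : loc_ideal (fun j => 'X_j) J A q ->
  is_laurent q /\ forall a, lcoef q a != 0 ->
    exists f m t, [/\ J f, m \in msupp f & a = mdegree m - cone_degree A t].
Proof.
move=> [f [t [Jf ->]]].
have -> : tofrac f / tofrac (\prod_(j in A) ('X_j : S)) ^+ t =
    laurent (scale_laurent 1 (- cone_degree A t) (mpoly_laurent f)).
  rewrite laurent_scale laurent_mpoly -xpow_cone rmorph1 mul1r mulrC; congr (_ * _).
  apply: (mulIf (xpow_neq0 (cone_degree A t))).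
  by rewrite mulVf ?xpow_neq0 // -xpowD addNr xpow0.
split; first by eexists.
move=> a; rewrite lcoefE coef_laurent_scale mul1r opprK /coef_laurent.
have [/mapP [[c b] /mapP [m mf [_ ->]]] /= e _|ar] := boolP (a + cone_degree A t \in map snd (mpoly_laurent f)).
  by exists f, m, t; split=> //; rewrite -e addrK.
rewrite big_seq_cond big1 ?eqxx // => p /andP [pr /eqP pa].
by move: ar; rewrite -pa map_f.
Qed.

Definition neg_supp a : {set 'I_n} := [set j | a j < 0].

Lemma loc_ideal_neg_supp A q : loc_ideal (fun j => 'X_j) (fun=> True) A q ->
  is_laurent q /\ forall a, lcoef q a != 0 -> neg_supp a \subset A.
Proof.
move=> /loc_ideal_laurent [lq lqa]; split=> // a /lqa [f [m [t [_ _ ->]]]].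
apply/subsetP => j; rewrite inE !ffunE; case: (j \in A) => //.
Qed.

Lemma loc_ideal_monomial J A a (t : nat) c (m : 'X_{1..n}) :
  is_ideal J -> J 'X_[m] -> mdegree m = a + cone_degree A t ->
  loc_ideal (fun j => 'X_j) J A (const c * xpow a).
Proof.
move=> [_ _ JM] Jm e; exists (c%:MP * 'X_[m]), t; split; first exact: JM.
rewrite tofracM -xpow_mdegree e xpowD -xpow_cone mulrA mulfK //.
exact: xpow_neq0.
Qed.

Lemma loc_ideal0 (J : S -> Prop) A : is_ideal J -> loc_ideal (fun j => 'X_j) J A 0.
Proof. by move=> [J0 _ _]; exists 0, 0%N; rewrite rmorph0 mul0r. Qed.

Lemma loc_idealD (J : S -> Prop) A q q' : is_ideal J ->
  loc_ideal (fun j => 'X_j) J A q -> loc_ideal (fun j => 'X_j) J A q' ->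
  loc_ideal (fun j => 'X_j) J A (q + q').
Proof.
move=> [_ JD JM] [f [t [Jf ->]]] [f' [t' [Jf' ->]]].
set x := \prod_(j in A) _; exists (f * x ^+ t' + f' * x ^+ t), (t + t')%N; split.
  by apply: JD; rewrite mulrC; apply: JM.
have x0 : tofrac x != 0 := prodX_neq0 A.
by rewrite addf_div ?expf_neq0 // exprD rmorphD !rmorphM !rmorphXn.
Qed.

Lemma loc_idealM (J : S -> Prop) A p q : is_ideal J ->
  loc_ideal (fun j => 'X_j) J A q -> loc_ideal (fun j => 'X_j) J A (tofrac p * q).
Proof.
move=> [_ _ JM] [f [t [Jf ->]]]; exists (p * f), t; split; first exact: JM.
by rewrite rmorphM mulrA.
Qed.

End Laurent.

(** * Monomials in the localizations of the second symbolic power *)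

Section SymbolicSquare.
Variables (k : fieldType) (n : nat) (Delta : {set {set 'I_n}}).
Local Notation S := {mpoly k[n]}.
Local Notation I := (symbolic_square (k := k) Delta).
Local Notation degree := {ffun 'I_n -> int}.
Implicit Types (A F : {set 'I_n}) (a : degree).

(** The order of x^m along P_F: the monomial lies in P_F^t iff its weight is at least t. *)
Definition weight F (m : 'X_{1..n}) : nat := \sum_(j | j \notin F) m j.

Lemma weightD F m m' : weight F (m + m')%MM = (weight F m + weight F m')%N.
Proof. by rewrite /weight -big_split; apply: eq_bigr => j _; rewrite mnmDE. Qed.

Lemma weight_ideal F t : is_ideal (fun f : S => forall m, m \in msupp f -> (t <= weight F m)%N).
Proof.
split=> [m|f g tf tg m|p f tf m]; first by rewrite msupp0.
  by move=> /msuppD_le; rewrite mem_cat => /orP [/tf|/tg].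
move=> /msuppM_le /allpairsP [[m1 m2] /= [_ /tf tm2 ->]].
by rewrite weightD (leq_trans tm2) // leq_addl.
Qed.

Lemma face_ideal_weight F f : face_ideal (k := k) F f ->
  forall m, m \in msupp f -> (1 <= weight F m)%N.
Proof.
move: f; apply: (ideal_gen_min (@weight_ideal F 1)).
move=> _ [j jF ->] m; rewrite msuppX inE => /eqP ->.
by rewrite /weight (bigD1 j) //= mnm1E eqxx.
Qed.

Lemma square_weight F f :
  ideal_mul (face_ideal (k := k) F) (face_ideal (k := k) F) f ->
  forall m, m \in msupp f -> (2 <= weight F m)%N.
Proof.
move: f; apply: (ideal_gen_min (@weight_ideal F 2)).
move=> _ [g [h [/face_ideal_weight g1 /face_ideal_weight h1 ->]]] m.
move=> /msuppM_le /allpairsP [[m1 m2] /= [/g1 gm1 /h1 hm2 ->]].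
by rewrite weightD (leq_add gm1 hm2).
Qed.

Lemma weight_pos F m : (0 < weight F m)%N ->
  exists j m', [/\ j \notin F, m = (m' + U_(j))%MM & weight F m = (weight F m').+1].
Proof.
move=> wm; have [j jF mj] : exists2 j, j \notin F & (0 < m j)%N.
  apply: NNPP => nj; move: wm; rewrite /weight big1 // => j jF.
  by case: (posnP (m j)) => // mj; case: nj; exists j.
exists j, (m - U_(j))%MM; have e : m = (m - U_(j) + U_(j))%MM.
  by rewrite submK // lep1mP -lt0n.
split=> //; rewrite {1}e weightD -addn1; congr (_ + _)%N.
rewrite /weight (bigD1 j) //= mnm1E eqxx big1 // => i /andP [_ ij].
by rewrite mnm1E eq_sym (negPf ij).
Qed.

Lemma symbolic_square_monomial m :
  (forall F, F \in facets Delta -> (2 <= weight F m)%N) -> I 'X_[m].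
Proof.
move=> wm F /wm w2; have [j [m1 [jF mE wE]]] := weight_pos (ltnW w2).
move: w2; rewrite wE ltnS => /weight_pos [j' [m2 [jF' m1E _]]].
rewrite mE m1E !mpolyXD -mulrA; 
have [_ _ M] : is_ideal (ideal_mul (face_ideal (k := k) F) (face_ideal (k := k) F)) :=
  ideal_gen_ideal _.
apply: M.
apply: ideal_gen_in; exists 'X_j', 'X_j; split=> //; apply: ideal_gen_in.
  by exists j'.
by exists j.
Qed.

(* The condition for x^a to lie in the localization of I at x_A. *)
Definition deg_in_loc A a : bool :=
  (neg_supp a \subset A) &&
  [forall F in facets Delta, (A \subset F) ==> (2 <= \sum_(j | j \notin F) a j)].

(** For A inside F, dividing by a power of x_A leaves the exponents outside F alone, so the weight
    of the numerator along F survives. *)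
Lemma loc_ideal_deg A q : loc_ideal (fun j => 'X_j) I A q ->
  is_laurent q /\ forall a, lcoef q a != 0 -> deg_in_loc A a.
Proof.
move=> Iq; have Tq : loc_ideal (fun j => 'X_j) (fun=> True) A q.
  by have [f [t [_ ->]]] := Iq; exists f, t.
have [lq nq] := loc_ideal_neg_supp Tq; split=> // a qa.
rewrite /deg_in_loc nq //; apply/forall_inP => F fF; apply/implyP => AF.
have [_ /(_ a qa) [f [m [t [If mf ->]]]]] := loc_ideal_laurent Iq.
have -> : \sum_(j | j \notin F) (mdegree m - cone_degree A t) j = (weight F m)%:Z.
  rewrite /weight (big_morph Posz PoszD (erefl _)); apply: eq_bigr => j jF.
  rewrite !ffunE (_ : j \in A = false) ?subr0 //.
  by apply: contraNF jF; apply: (subsetP AF).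
by rewrite lez_nat; apply: square_weight mf; apply: If.
Qed.

Lemma deg_in_loc_ideal A a c : deg_in_loc A a ->
  loc_ideal (fun j => 'X_j : S) I A (const n c * xpow k a).
Proof.
move=> /andP [nA /forall_inP aF].
(* The summand 2 takes care of the facets not containing A: a vertex of A outside such a facet gets
   exponent at least 2 in the numerator. *)
pose t := (2 + \sum_j absz (a j))%N.
have pos j : j \notin A -> 0 <= a j.
  by apply: contraNT; rewrite -ltNge => aj; apply: (subsetP nA); rewrite inE.
have posA j : 2 <= a j + t%:Z.
  rewrite /t (bigD1 j) //= !PoszD addrCA lerDl addrA.
  by apply: (addr_ge0 (x := a j + _)); rewrite ?int_add_abs_ge0.
pose m : 'X_{1..n} := [multinom absz ((a + cone_degree A t)%R j) | j < n].
have mE : mdegree m = a + cone_degree A t.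
  apply/ffunP => j; rewrite ffunE mnmE gez0_abs // !ffunE.
  by case: ifP => [_|/negbT /pos]; [apply: le_trans (posA j) | rewrite addr0].
apply: (@loc_ideal_monomial k n I A a t c m) => //; first exact: symbolic_square_ideal.
have mj j : (m j)%:Z = a j + (if j \in A then t%:Z else 0).
  by have /ffunP/(_ j) := mE; rewrite !ffunE.
apply: symbolic_square_monomial => F fF; have [AF|] := boolP (A \subset F).
  rewrite -lez_nat; apply: le_trans (implyP (aF F fF) AF) _.
  rewrite /weight (big_morph Posz PoszD (erefl _)) ler_sum // => j jF.
  rewrite mj (_ : j \in A = false) ?addr0 //; apply: contraNF jF; exact: (subsetP AF).
move=> /subsetPn [j jA jF]; rewrite /weight (bigD1 j) //=.
by apply: leq_trans (leq_addr _ _); rewrite -lez_nat mj jA.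
Qed.

End SymbolicSquare.

(** * The Cech complex *)

Lemma is_submodule_sum (R : idomainType) (n : nat) (N : cech_family R n -> Prop)
    (T : Type) (s : seq T) (P : pred T) (f : T -> cech_family R n) :
  is_submodule N -> (forall t, P t -> N (f t)) -> N (\sum_(t <- s | P t) f t).
Proof. by move=> [N0 ND _] Nf; apply: big_ind. Qed.

Section Cech.
Variables (k : fieldType) (n : nat) (Delta : {set {set 'I_n}}).
Local Notation S := {mpoly k[n]}.
Local Notation K := {fraction S}.
Local Notation I := (symbolic_square (k := k) Delta).
Local Notation degree := {ffun 'I_n -> int}.
Local Notation family := {ffun {set 'I_n} -> K^o}.
Local Notation X := (fun j : 'I_n => 'X_j : S).
Local Notation T := (fun _ : S => True).
Implicit Types (A B F G V : {set 'I_n}) (a : degree) (u v w : family).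
Implicit Types (phi psi : {set 'I_n} -> k).

Lemma true_ideal : is_ideal T. Proof. by []. Qed.

Lemma cech_diffE u A : cech_diff u A = codiff u A.
Proof. by rewrite ffunE. Qed.

Lemma familyD u v A : (u + v) A = u A + v A :> K.
Proof. by rewrite ffunE. Qed.

Lemma familyZ (q : K) u A : (q *: u) A = q * u A :> K.
Proof. by rewrite ffunE. Qed.

Lemma family_sum (J : Type) (s : seq J) (P : pred J) (f : J -> family) A :
  (\sum_(j <- s | P j) f j) A = \sum_(j <- s | P j) (f j A : K) :> K.
Proof. by rewrite sum_ffunE. Qed.

Lemma cech_diffD u v : cech_diff (u + v) = cech_diff u + cech_diff v.
Proof.
apply/ffunP => A; rewrite familyD !cech_diffE /codiff -big_split.
by apply: eq_bigr => a _; rewrite familyD mulrDr.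
Qed.

Lemma cech_diffZ (q : K) u : cech_diff (q *: u) = q *: cech_diff u.
Proof.
apply/ffunP => A; rewrite familyZ !cech_diffE /codiff big_distrr.
by apply: eq_bigr => a _; rewrite familyZ mulrCA.
Qed.

Section Cochains.
Variables (J : S -> Prop).
Hypothesis iJ : is_ideal J.

Lemma cech_cochain_submodule i : is_submodule (cech_cochain X J i).
Proof.
split=> [A|u v Cu Cv A|p u Cu A].
- by rewrite ffunE; case: ifP => // _; apply: loc_ideal0.
- rewrite familyD; have := Cu A; have := Cv A; case: ifP => _; first by move=> *; apply: loc_idealD.
  by move=> -> ->; rewrite addr0.
- rewrite familyZ; have := Cu A; case: ifP => _; first by apply: loc_idealM.
  by move=> ->; rewrite mulr0.
Qed.

Lemma loc_idealS A B q : A \subset B -> loc_ideal X J A q -> loc_ideal X J B q.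
Proof.
move=> AB [f [t [Jf ->]]]; exists ((\prod_(j in B :\: A) 'X_j) ^+ t * f), t; split.
  by case: iJ => _ _; apply.
have -> : \prod_(j in B) ('X_j : S) = \prod_(j in B :\: A) 'X_j * \prod_(j in A) 'X_j.
  by rewrite (big_setID A) /= (setIidPr AB) mulrC.
have n0 := @prodX_neq0 k n.
rewrite !rmorphM !rmorphXn /= exprMn -mulf_div divff ?expf_neq0 //.
by rewrite mul1r.
Qed.

Lemma cech_diff_cochain i u : cech_cochain X J i u -> cech_cochain X J i.+1 (cech_diff u).
Proof.
move=> Cu A; rewrite cech_diffE /codiff.
have cA j : j \in A -> (#|A :\ j| == i) = (#|A| == i.+1) by move=> jA; rewrite (cardsD1 j A) jA.
case: ifP => Ai.
  apply: (big_ind (loc_ideal X J A)); first exact: loc_ideal0.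
    by move=> *; apply: loc_idealD.
  move=> a aA; have := Cu (A :\ a); rewrite cA // Ai => /(loc_idealS (subD1set A a)).
  rewrite (_ : sgn _ A a = tofrac (sgn S A a)); first exact: loc_idealM.
  by rewrite /sgn rmorph_sign.
by rewrite big1 // => a aA; have := Cu (A :\ a); rewrite cA // Ai => ->; rewrite mulr0.
Qed.

End Cochains.

Lemma cech_cocycle_submodule i : is_submodule (cech_cocycle X I i).
Proof.
have [T0 TD TZ] := cech_cochain_submodule true_ideal i.
have [I0 ID IZ] := cech_cochain_submodule (symbolic_square_ideal k Delta) i.+1.
split=> [|u v [Tu Iu] [Tv Iv]|p u [Tu Iu]].
- split=> //; rewrite (_ : cech_diff 0 = 0) //.
  by rewrite -[X in cech_diff X](scale0r (0 : family)) cech_diffZ scale0r.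
- by split; rewrite ?cech_diffD; [apply: TD | apply: ID].
- by split; rewrite ?cech_diffZ; [apply: TZ | apply: IZ].
Qed.

Definition pre_cochain i v : Prop :=
  if i is i'.+1 then cech_cochain X T i' v else forall A, v A = 0.

Lemma pre_cochain_submodule i : is_submodule (pre_cochain i).
Proof.
case: i => [|i]; last exact: cech_cochain_submodule.
split=> [A|u v u0 v0 A|p u u0 A]; first by rewrite ffunE.
  by rewrite familyD u0 v0 addr0.
by rewrite familyZ u0 mulr0.
Qed.

Lemma cech_coboundaryP i u : cech_coboundary X I i u <->
  exists v w, [/\ pre_cochain i v, cech_cochain X I i w & u = cech_diff v + w].
Proof.
split=> -[v [w [vP wP e]]]; exists v, w; split=> //.
  by apply/ffunP => A; rewrite familyD e.
by move=> A; rewrite e familyD.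
Qed.

Lemma cech_coboundary_submodule i : is_submodule (cech_coboundary X I i).
Proof.
have [P0 PD PZ] := pre_cochain_submodule i.
have [I0 ID IZ] := cech_cochain_submodule (symbolic_square_ideal k Delta) i.
split=> [|u u' /cech_coboundaryP [v [w [vP wP ->]]] /cech_coboundaryP [v' [w' [vP' wP' ->]]]
        |p u /cech_coboundaryP [v [w [vP wP ->]]]]; apply/cech_coboundaryP.
- exists 0, 0; split=> //; rewrite addr0.
  by rewrite -[X in cech_diff X](scale0r (0 : family)) cech_diffZ scale0r.
- exists (v + v'), (w + w'); split; [exact: PD | exact: ID | by rewrite cech_diffD addrACA].
- exists (tofrac p *: v), (tofrac p *: w).
  by split; [exact: PZ | exact: IZ | rewrite cech_diffZ scalerDr].
Qed.

Lemma cech_diffK u : cech_diff (cech_diff u) = 0.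
Proof.
apply/ffunP => A; rewrite cech_diffE ffunE -[RHS](codiffK (fun A => u A : K) A).
by apply: eq_bigr => a _; rewrite cech_diffE.
Qed.

Lemma cech_coboundary_cocycle i u : cech_coboundary X I i u -> cech_cocycle X I i u.
Proof.
move=> /cech_coboundaryP [v [w [vP wP ->]]].
have [T0 TD TZ] := cech_cochain_submodule true_ideal i.
have iI := symbolic_square_ideal k Delta.
split; last by rewrite cech_diffD cech_diffK add0r; apply: cech_diff_cochain.
apply: TD; last first.
  move=> A; have := wP A; case: ifP => // _ [f [t [_ ->]]].
  by exists f, t.
case: i vP {wP T0 TZ} => [v0|i vP]; last exact: cech_diff_cochain.
rewrite (_ : cech_diff v = 0); first by case: (cech_cochain_submodule true_ideal 0).
by apply/ffunP => A; rewrite cech_diffE ffunE /codiff big1 // => a _; rewrite v0 mulr0.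
Qed.

(** * The homogeneous parts of the Cech complex *)

Lemma cochain_laurent J i u A : is_ideal J -> cech_cochain X J i u -> is_laurent (u A).
Proof.
move=> iJ Cu; have := Cu A; case: ifP => _; first by case/loc_ideal_laurent.
by move=> ->; apply: is_laurent0.
Qed.

Lemma cochain_coef i u A a : cech_cochain X T i u -> lcoef (u A) a != 0 ->
  #|A| = i /\ neg_supp a \subset A.
Proof.
move=> Cu; have := Cu A; case: ifP => [/eqP Ai|_ ->]; last by rewrite lcoef0 eqxx.
by move=> /loc_ideal_neg_supp [_ nA] /nA.
Qed.

Lemma cochain_ideal_coef i u A a : cech_cochain X I i u -> lcoef (u A) a != 0 ->
  deg_in_loc Delta A a.
Proof.
move=> Cu; have := Cu A; case: ifP => [/eqP Ai|_ ->]; last by rewrite lcoef0 eqxx.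
by move=> /loc_ideal_deg [_ dA] /dA.
Qed.

Lemma sgn_const A j : sgn K A j = const n (sgn k A j).
Proof. by rewrite /sgn rmorph_sign. Qed.

Lemma lcoef_codiff (u : {set 'I_n} -> K) A a : (forall B, is_laurent (u B)) ->
  lcoef (codiff u A) a = codiff (fun B => lcoef (u B) a) A.
Proof.
move=> lu; rewrite /codiff lcoef_sum => [|j _].
  by apply: eq_bigr => j _; rewrite sgn_const lcoefZ.
by rewrite sgn_const; apply: is_laurentC.
Qed.

Lemma is_laurent_codiff (u : {set 'I_n} -> K) A : (forall B, is_laurent (u B)) ->
  is_laurent (codiff u A).
Proof.
move=> lu; apply: is_laurent_sum => j _; rewrite sgn_const; exact: is_laurentC.
Qed.

Definition homogeneous phi a : family := [ffun A => const n (phi A) * xpow k a].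

Lemma cech_diff_homogeneous phi a :
  cech_diff (homogeneous phi a) = homogeneous (codiff phi) a.
Proof.
apply/ffunP => A; rewrite cech_diffE ffunE /codiff rmorph_sum big_distrl.
by apply: eq_bigr => j _; rewrite ffunE sgn_const rmorphM mulrA.
Qed.

Lemma homogeneous_cochain phi a i :
  (forall A, phi A != 0 -> #|A| = i /\ neg_supp a \subset A) ->
  cech_cochain X T i (homogeneous phi a).
Proof.
move=> suppP A; rewrite ffunE; have [->|/suppP [-> nA]] := eqVneq (phi A) 0.
  by rewrite rmorph0 mul0r; case: ifP => // _; apply: loc_ideal0.
rewrite eqxx; pose m : 'X_{1..n} := [multinom absz ((a + cone_degree A (\sum_j absz (a j)))%R j) | j < n].
apply: (@loc_ideal_monomial k n T A a (\sum_j absz (a j)) _ m) => //.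
apply/ffunP => j; rewrite ffunE mnmE gez0_abs // !ffunE.
case: ifP => [_|jA].
  rewrite (bigD1 j) //= PoszD addrA.
  by apply: (addr_ge0 (x := a j + _)); rewrite ?int_add_abs_ge0.
rewrite addr0; move/negbT: jA; apply: contraNT; rewrite -ltNge => aj.
by apply: (subsetP nA); rewrite inE.
Qed.

Lemma homogeneous_ideal_cochain phi a i :
  (forall A, phi A != 0 -> #|A| = i /\ deg_in_loc Delta A a) ->
  cech_cochain X I i (homogeneous phi a).
Proof.
move=> suppP A; rewrite ffunE; have [->|/suppP [-> dA]] := eqVneq (phi A) 0.
  rewrite rmorph0 mul0r; case: ifP => // _; apply: loc_ideal0; exact: symbolic_square_ideal.
by rewrite eqxx; apply: deg_in_loc_ideal.
Qed.

Lemma homogeneous_coboundary phi psi a i :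
    (forall A, phi A != 0 -> #|A| = i /\ neg_supp a \subset A) ->
    (forall B, psi B != 0 -> #|B|.+1 = i /\ neg_supp a \subset B) ->
    (forall A, #|A| = i -> neg_supp a \subset A -> ~~ deg_in_loc Delta A a ->
       phi A = codiff psi A) ->
  cech_coboundary X I i (homogeneous phi a).
Proof.
move=> phiS psiS e; apply/cech_coboundaryP.
(* phi and [codiff psi] can differ only at those A for which x^a lies in the localization of I, so
   the difference is a cochain of I. *)
exists (homogeneous psi a), (homogeneous (fun A => phi A - codiff psi A) a); split.
- case: i psiS {phiS e} => [|i] psiS.
    by move=> A; rewrite ffunE; have [->|/psiS []] := eqVneq (psi A) 0; rewrite ?rmorph0 ?mul0r.
  by apply: homogeneous_cochain => B /psiS [[]].
- apply: homogeneous_ideal_cochain => A nz.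
  have [Ai nA] : #|A| = i /\ neg_supp a \subset A.
    have [phi0|/phiS //] := eqVneq (phi A) 0.
    move: nz; rewrite phi0 sub0r oppr_eq0 => nz.
    have [j jA] : exists2 j, j \in A & psi (A :\ j) != 0.
      apply: NNPP => noj; case/eqP: nz; apply: big1 => j jA.
      have [->|pj] := eqVneq (psi (A :\ j)) 0; first by rewrite mulr0.
      by case: noj; exists j.
    move=> /psiS [<- nA]; split; first by rewrite (cardsD1 j A) jA.
    exact: subset_trans nA (subD1set _ _).
  split=> //; apply: contraNT nz => dA; rewrite -e ?subrr //.
- apply/ffunP => A; rewrite familyD cech_diff_homogeneous !ffunE.
  by rewrite rmorphB -mulrDl addrC subrK.
Qed.

(** A facet F containing A contains the negative support, so outside F the exponents are 1 on V and
    0 elsewhere, and they add up to the number of vertices of V missed by F. *)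
Lemma deg_in_loc_near_star a V A : (forall j, j \in V -> a j = 1) ->
  (forall j, j \notin V -> a j <= 0) -> neg_supp a \subset A ->
  deg_in_loc Delta A a = (A \notin near_star Delta V).
Proof.
move=> aV an nA; rewrite /deg_in_loc nA /=.
have sumE F : A \subset F -> \sum_(j | j \notin F) a j = #|V :\: F|%:Z.
  move=> AF; rewrite -sum1_card (big_morph Posz PoszD (erefl _)) big_mkcond [RHS]big_mkcond.
  apply: eq_bigr => j _; rewrite inE; case jF: (j \in F) => //=.
  case jV: (j \in V); first exact: aV.
  apply/eqP; rewrite eq_le an ?jV //= leNgt; apply: contraFN jF => aj.
  by apply: (subsetP AF); apply: (subsetP nA); rewrite inE.
apply/forall_inP/idP => [h|An F fF].
  apply/near_starP => -[F [fF AF VF]].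
  by have := implyP (h F fF) AF; rewrite sumE // lez_nat leqNgt ltnS VF.
apply/implyP => AF; rewrite sumE // lez_nat leqNgt ltnS; apply/negP => VF.
by case/near_starP: An; exists F.
Qed.

(* In degree a_t, with value - t - 1 on G, the class phi cannot come from the
   degrees a_s with s < t, since S lives in nonnegative degrees. *)
Lemma gcm_links_acyclic :
  generalized_cohen_macaulay I -> links_acyclic k Delta.
Proof.
move=> gcm G V c Gn0 dGV cG; apply/link_homology; first exact: near_star_complex.
set i := (c + #|G|)%N in cG *.
have kd : krull_dim_ge I i.+1.
  have [F fF Fd] := dim_succ_facet (leq_ltn_trans (leq0n _) cG).
  by apply: krull_dim_ge_facet fF _; rewrite Fd.
have [l lP] := gcm i kd.
move=> phi suppG cocyc; apply: NNPP => nopsi.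
pose phi' A := if #|A| == i then phi A else 0.
pose a (t : nat) : degree :=
  [ffun j => if j \in G then - (t.+1)%:Z else if j \in V then 1 else 0].
have na t : neg_supp (a t) = G.
  apply/setP => j; rewrite inE ffunE; case: (j \in G); first by rewrite oppr_lt0.
  by case: (j \in V).
have aV t j : j \in V -> a t j = 1.
  by move=> jV; rewrite ffunE (disjointFl dGV jV) jV.
have anV t j : j \notin V -> a t j <= 0.
  by move=> /negPf jV; rewrite ffunE jV; case: ifP => // _; rewrite oppr_le0.
have phi'S A : phi' A != 0 -> #|A| = i /\ G \subset A.
  by rewrite /phi'; case: (_ =P i) => [? /suppG|_]; rewrite ?eqxx.
pose u t := homogeneous phi' (a t).
have uZ t : cech_cocycle X I i (u t).
  split; first by apply: homogeneous_cochain => A; rewrite na; apply: phi'S.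
  rewrite cech_diff_homogeneous; apply: homogeneous_ideal_cochain => A nz.
  have [j jA] : exists2 j, j \in A & phi' (A :\ j) != 0.
    apply: NNPP => noj; case/eqP: nz; apply: big1 => j jA.
    have [->|pj] := eqVneq (phi' (A :\ j)) 0; first by rewrite mulr0.
    by case: noj; exists j.
  move=> /phi'S [Aj GA].
  have Ai : #|A| = i.+1 by rewrite (cardsD1 j A) jA Aj.
  have GA' : G \subset A := subset_trans GA (subD1set _ _).
  split=> //; rewrite (deg_in_loc_near_star (aV t) (anV t)) ?na //.
  apply: contraNN nz => An; rewrite -(cocyc A) //; apply/eqP.
  apply: eq_codiff => j' jA'; rewrite /phi' (_ : _ == _) //.
  by move: Ai; rewrite (cardsD1 j' A) jA' add1n => -[->].
(* The submodule generated by the coboundaries and u 0, ..., u (j - 1). If phi were not a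
   coboundary, these would increase strictly for ever. *)
pose N j w := exists b (p : nat -> S), cech_coboundary X I i b /\
  w = b + \sum_(t < j) tofrac (p t) *: u t.
have [B0 BD BZ] := cech_coboundary_submodule i.
have [Z0 ZD ZZ] := cech_cocycle_submodule i.
suff : (l.+1 <= l)%N by rewrite ltnn.
apply: (lP l.+1 N) => [j _|j _].
  split; first split.
  - by exists 0, (fun=> 0); split=> //; rewrite big1 ?addr0 // => t _; rewrite rmorph0 scale0r.
  - move=> _ _ [b [p [Bb ->]]] [b' [p' [Bb' ->]]]; exists (b + b'), (fun t => p t + p' t).
    split; first exact: BD.
    rewrite addrACA -big_split; congr (_ + _); apply: eq_bigr => t _.
    by rewrite rmorphD scalerDl.
  - move=> p _ [b [p' [Bb ->]]]; exists (tofrac p *: b), (fun t => p * p' t).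
    split; first exact: BZ.
    rewrite scalerDr scaler_sumr; congr (_ + _); apply: eq_bigr => t _.
    by rewrite rmorphM scalerA.
  - move=> b Bb; exists b, (fun=> 0); split=> //.
    by rewrite big1 ?addr0 // => t _; rewrite rmorph0 scale0r.
  - move=> _ [b [p [Bb ->]]]; apply: ZD; first exact: cech_coboundary_cocycle.
    refine (@is_submodule_sum _ _ _ _ _ _ _ (cech_cocycle_submodule i) _) => t _.
    exact: ZZ (uZ t).
split=> [_ [b [p [Bb ->]]]|].
  exists b, (fun t => if (t < j)%N then p t else 0); split=> //; congr (_ + _).
  rewrite big_ord_recr /= ltnn rmorph0 scale0r addr0.
  by apply: eq_bigr => t _; rewrite ltn_ord.
exists (u j).
  exists 0, (fun t => (t == j)%:R); split=> //; rewrite add0r big_ord_recr /= eqxx rmorph1 scale1r.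
  rewrite big1 ?add0r // => t _; rewrite (_ : _ == _ = false) ?rmorph0 ?scale0r //.
  by rewrite ltn_eqF.
(* Compare coefficients in degree [a j]. On [near_star Delta V] the term w contributes none, nor do
   the multiples of u t for t < j, so phi is the coboundary of the coefficients of v. *)
move=> [b [p [/cech_coboundaryP [v [w [vP wP ->]]] e]]]; apply: nopsi.
have lv B : is_laurent (v B).
  case: (i) vP => [|i'] vP; first by rewrite vP; apply: is_laurent0.
  by apply: cochain_laurent vP.
have lw B : is_laurent (w B) by apply: cochain_laurent wP; apply: symbolic_square_ideal.
exists (fun B => lcoef (v B) (a j)); split.
  move=> B; case: (i) vP => [|i'] vP; first by rewrite vP lcoef0 eqxx.
  by move=> /(cochain_coef vP) [-> ]; rewrite na => ->; rewrite eqxx.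
move=> A An GA Ai.
have lpu t : is_laurent (tofrac (p t) * u t A).
  rewrite -laurent_mpoly ffunE mulrC; apply: is_laurentZ; by eexists.
have : lcoef (u j A) (a j) = phi A by rewrite ffunE lcoef_monomial eqxx /phi' Ai eqxx.
rewrite {1}e !familyD family_sum cech_diffE => <-.
under eq_bigr do rewrite familyZ.
have lc : is_laurent (codiff v A) by apply: is_laurent_codiff.
rewrite lcoefD; [|exact: is_laurentD|by apply: is_laurent_sum].
rewrite lcoefD //.
rewrite lcoef_codiff // lcoef_sum // big1 ?addr0 => [|t _].
  have [->|/(cochain_ideal_coef wP)] := eqVneq (lcoef (w A) (a j)) 0; first by rewrite addr0.
  by rewrite (deg_in_loc_near_star (aV j) (anV j)) ?na // An.
rewrite ffunE mulrC lcoefZX; last by rewrite -laurent_mpoly; eexists.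
rewrite -laurent_mpoly lcoefE /coef_laurent big_map big_pred0 ?mulr0 // => m /=.
have [g gG] := set0Pn _ Gn0; apply/negP => /eqP /ffunP /(_ g); rewrite !ffunE gG.
rewrite opprK addrC => h.
have : (m g)%:Z < 0.
  rewrite h subr_lt0 ltz_nat ltnS; exact: ltn_ord.
by rewrite ltz_nat.
Qed.

(** The last hypothesis disposes of the squarefree degrees, whose G is empty and about which
    acyclicity says nothing. In all other degrees the class dies, by a cone or by an acyclic
    link. *)
Lemma homogeneous_cocycle_coboundary phi a i : links_acyclic k Delta -> (i < dim_succ Delta)%N ->
    (forall A, phi A != 0 -> #|A| = i /\ neg_supp a \subset A) ->
    (forall A, #|A| = i.+1 -> neg_supp a \subset A -> ~~ deg_in_loc Delta A a -> codiff phi A = 0) ->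
    ((forall j, 0 <= a j <= 1) -> forall A, phi A = 0) ->
  cech_coboundary X I i (homogeneous phi a).
Proof.
move=> acyc id phiS cocyc small.
suff [psi [psiS psiE]] : exists psi,
    (forall B, psi B != 0 -> #|B|.+1 = i /\ neg_supp a \subset B) /\
    (forall A, #|A| = i -> neg_supp a \subset A -> ~~ deg_in_loc Delta A a ->
       phi A = codiff psi A).
  exact: homogeneous_coboundary phiS psiS psiE.
have [[w aw]|no2] := classic (exists w : 'I_n, 2 <= a w).
  exists (fun B => if w \in B then 0 else sgn k B w * phi (w |: B)); split.
    move=> B; case: ifP => wB; first by rewrite eqxx.
    rewrite mulf_eq0 negb_or => /andP [_ /phiS [Bi nB]]; split.
      by rewrite -Bi cardsU1 wB.
    apply/subsetP => j jn; have := subsetP nB j jn; rewrite !inE => /orP [/eqP jw|//].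
    by move: jn; rewrite inE jw ltNge (le_trans _ aw).
  move=> A Ai nA dA; rewrite -[LHS](cone_homotopy phi w); case: ifP => wA; first by rewrite addr0.
  rewrite [codiff phi _]cocyc ?mulr0 ?addr0 //.
  - by rewrite cardsU1 wA Ai.
  - by apply: subset_trans nA (subsetUr _ _).
  (* A facet F containing A with sum below 2 must contain w, because a_w >= 2 and the exponents
     outside F are nonnegative. The same F then works for [w |: A]. *)
  move: dA; rewrite /deg_in_loc nA negb_and /= => /forall_inPn [F fF].
  rewrite negb_imply => /andP [AF Fa]; apply/nandP; right.
  apply/forall_inPn; exists F => //; rewrite negb_imply Fa subUset AF sub1set !andbT.
  apply: contraNT Fa => wF; rewrite (bigD1 w) //= -[2]addr0; apply: lerD => //.
  apply: sumr_ge0 => j /andP [jF _]; rewrite leNgt; apply: contraNN jF => aj.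
  by apply: (subsetP AF); apply: (subsetP nA); rewrite inE.
have a1 j : a j <= 1.
  rewrite leNgt; apply/negP => aj; apply: no2; exists j.
  by rewrite -lez1D in aj.
have [n0|nn0] := eqVneq (neg_supp a) set0.
  exists (fun=> 0); split=> [B|A _ _ _]; first by rewrite eqxx.
  rewrite small; first by rewrite /codiff big1 // => j _; rewrite mulr0.
  move=> j; rewrite a1 andbT leNgt; apply/negP => aj.
  by have /setP/(_ j) := n0; rewrite !inE aj.
pose V := [set j | a j == 1].
have aV j : j \in V -> a j = 1 by rewrite inE => /eqP.
have anV j : j \notin V -> a j <= 0.
  by rewrite inE => aj; have := a1 j; rewrite le_eqVlt (negPf aj) /= -ltzD1 add0r.
have dV : [disjoint neg_supp a & V].
  by rewrite disjoints_subset; apply/subsetP => j; rewrite !inE; apply: contraTN => /eqP ->.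
have [iG|Gi] := ltnP i #|neg_supp a|.
  exists (fun=> 0); split=> [B|A Ai nA _]; first by rewrite eqxx.
  by have := subset_leq_card nA; rewrite Ai leqNgt iG.
have iE : (i = i - #|neg_supp a| + #|neg_supp a|)%N by rewrite subnK.
have rel : relative_cohomology_vanishes k (neg_supp a) (near_star Delta V) i.
  rewrite {1}iE; apply/link_homology; first exact: near_star_complex.
  by apply: acyc => //; rewrite -iE.
have [A An nA Ai|psi [psiS psiE]] := rel phi (fun A pA => (phiS A pA).2).
  by apply: cocyc => //; rewrite (deg_in_loc_near_star aV anV nA) negbK.
exists psi; split=> [B /psiS /andP [-> /eqP ->] //|A Ai nA].
by rewrite (deg_in_loc_near_star aV anV nA) negbK => An; apply: psiE.
Qed.

Definition squarefree_degree V : degree := [ffun j => (j \in V)%:R].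

(** u is a finite sum of homogeneous parts, and each part is again a cocycle since the localizations
    of I are graded. *)
Lemma cocycle_coboundary i u : links_acyclic k Delta -> (i < dim_succ Delta)%N ->
    cech_cocycle X I i u ->
    (forall V A, lcoef (u A) (squarefree_degree V) = 0) ->
  cech_coboundary X I i u.
Proof.
move=> acyc id [uT uI] u0.
have lu A : is_laurent (u A) by apply: cochain_laurent uT.
have [r rE] : exists r : {set 'I_n} -> seq (k * degree), forall A, u A = laurent (r A).
  exact: (@fin_all_exists _ (fun=> seq (k * degree)) (fun A r => u A = laurent r)).
pose s := undup (flatten [seq map snd (r A) | A <- enum {: {set 'I_n}}]).
have uE : u = \sum_(a <- s) homogeneous (fun A => lcoef (u A) a) a.
  apply/ffunP => A; rewrite family_sum rE (@laurent_expansion _ _ (r A) s) ?undup_uniq //.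
    by apply: eq_bigr => a _; rewrite ffunE rE.
  move=> a ar; rewrite mem_undup; apply/flattenP; exists (map snd (r A)) => //.
  by apply: map_f; rewrite mem_enum.
rewrite uE; refine (@is_submodule_sum _ _ _ _ _ _ _ (cech_coboundary_submodule i) _) => a _.
apply: homogeneous_cocycle_coboundary => // [A|A Ai nA|aj A].
- exact: cochain_coef.
- apply: contraNeq => nz; apply: (cochain_ideal_coef uI).
  by rewrite cech_diffE lcoef_codiff.
- rewrite -[RHS](u0 [set j | a j == 1] A); congr (lcoef _ _); apply/ffunP => j.
  rewrite ffunE inE; case: eqP => [->//|/eqP aj1]; apply/eqP.
  have /andP [a0 a1] := aj j; rewrite eq_le a0 andbT.
  by move: a1; rewrite [a j <= 1]le_eqVlt (negPf aj1) /= -ltzD1 add0r.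
Qed.

(* Modulo coboundaries a cocycle is determined by its finitely many
   coefficients in squarefree degrees, which bounds the length of chains. *)
Lemma links_acyclic_gcm :
  links_acyclic k Delta -> generalized_cohen_macaulay I.
Proof.
move=> acyc i /krull_dim_symbolic_square id.
(* One coefficient for each squarefree degree V and each index A of the family. *)
exists #|{: {set 'I_n} * {set 'I_n}}| => m N Nsub Nstr.
rewrite leqNgt; apply/negP => ltm.
have [u uP] : exists u : 'I_m -> family, forall j : 'I_m, N j.+1 (u j) /\ ~ N j (u j).
  apply: (@fin_all_exists _ (fun=> family) (fun (j : 'I_m) u => N j.+1 u /\ ~ N j u)) => j.
  by have [_ [w]] := Nstr j (ltn_ord j); exists w.
have [|v [[t0 vt0] vrel]] := @linear_relation k 'I_m _ (fun j p =>
    lcoef (u j p.2) (squarefree_degree p.1)).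
  by rewrite card_ord.
(* With t the last index that occurs, the relation expresses u t through a coboundary and the u j
   with j < t, all of which lie in [N t]. *)
have [t vt tmax] := @arg_maxnP _ t0 (fun j => v j != 0) val vt0.
have Nmono j1 j2 w : (j1 <= j2)%N -> (j2 <= m)%N -> N j1 w -> N j2 w.
  elim: j2 => [|j2 IH]; first by rewrite leqn0 => /eqP ->.
  rewrite leq_eqVlt => /orP [/eqP -> //|j12] j2m Nw.
  by case: (Nstr j2 j2m) => inc _; apply: inc; apply: IH => //; apply: ltnW.
have [[N0 ND NZ] BN NZc] := Nsub t (ltnW (ltn_ord t)).
have uZ j : cech_cocycle X I i (u j).
  by have [_ _] := Nsub j.+1 (ltn_ord j); apply; case: (uP j).
pose s := \sum_j const n (v j) *: u j.
have Bs : cech_coboundary X I i s.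
  apply: cocycle_coboundary => // [|V A].
    refine (@is_submodule_sum _ _ _ _ _ _ _ (cech_cocycle_submodule i) _) => j _.
    by have [_ _ ZZ] := cech_cocycle_submodule i; apply: ZZ.
  have lu j : is_laurent (u j A) by have [uT _] := uZ j; apply: cochain_laurent uT.
  rewrite family_sum lcoef_sum => [|j _]; last by rewrite familyZ; apply: is_laurentC.
  by rewrite -[RHS](vrel (V, A)); apply: eq_bigr => j _; rewrite familyZ lcoefZ.
case: (uP t) => _; apply.
have -> : u t = const n (v t)^-1 *: (s + \sum_(j | j != t) const n (- v j) *: u j).
  rewrite /s (bigD1 t) //= -addrA -big_split big1 => [|j _].
    by rewrite addr0 scalerA -rmorphM mulVf // rmorph1 scale1r.
  by rewrite /= -scalerDl -rmorphD subrr rmorph0 scale0r.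
apply: (NZ); apply: (ND); first exact: BN.
refine (@is_submodule_sum _ _ (N t) _ _ _ _ (And3 N0 ND NZ) _) => j jt.
have [->|vj] := eqVneq (v j) 0; first by rewrite oppr0 rmorph0 scale0r.
apply: (NZ); apply: (Nmono j.+1) => //; last by case: (uP j).
  by rewrite ltn_neqAle; apply/andP; split; [exact: jt | exact: tmax].
exact: ltnW.
Qed.

End Cech.

Theorem corollary3p3 (k : fieldType) (n : nat) (Delta : {set {set 'I_n}})
    (hDelta : simplicial_complex Delta) :
  generalized_cohen_macaulay (symbolic_square (k := k) Delta) <->
  buchsbaum k Delta /\
  forall V : {set 'I_n}, (1 <= #|V| <= dim_succ Delta)%N ->
    buchsbaum k (\bigcup_(i in V) star Delta (V :\ i)).
Proof.
rewrite buchsbaum_links_acyclic //.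
by split; [apply: gcm_links_acyclic | apply: links_acyclic_gcm].
Qed.
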